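(* Let $K$ be a field, $R=K[x_1,\dots,x_n]$, and let $I\subset R$ be a matroidal ideal of degree $d$ which is full-supported and satisfies $\gcd(I)=1$. Then $\operatorname{astab}(I)=1$ if and only if $\operatorname{dstab}(I)=1$. In particular, in this case (i.e. when these equivalent conditions hold) $I=\mathfrak{p}_1\mathfrak{p}_2\cdots\mathfrak{p}_d$ for some monomial prime ideals $\mathfrak{p}_1,\dots,\mathfrak{p}_d$ of $R$ with $G(\mathfrak{p}_i)\cap G(\mathfrak{p}_j)=\emptyset$ for all $1\le i\ne j\le d$.
   Context: For a monomial ideal $I$ of $R=K[x_1,\dots,x_n]$, $G(I)$ denotes its unique minimal set of monomial generators. $I$ is full-supported if every variable $x_1,\dots,x_n$ divides some element of $G(I)$; $\gcd(I)$ is the greatest common divisor of the elements of $G(I)$. A monomial ideal $I$ is polymatroidal of degree $d$ if it is generated by monomials of the single degree $d$ and for any $u,v\in G(I)$ and any $i$ with $\deg_{x_i}(u)>\deg_{x_i}(v)$ there is $j$ with $\deg_{x_j}(u)<\deg_{x_j}(v)$ and $x_j(u/x_i)\in I$. It is matroidal if moreover it is generated by square-free monomials. A monomial prime ideal is a prime ideal generated by a set of variables. $\operatorname{Ass}(J)$ denotes the set of associated primes of $R/J$. By Brodmann, $\operatorname{Ass}(I^t)$ and $\operatorname{depth} R/I^t$ are constant for large $t$. $\operatorname{astab}(I)$ is the smallest integer $t_0\ge 1$ with $\operatorname{Ass}(I^t)=\operatorname{Ass}(I^{t_0})$ for all $t\ge t_0$, and $\operatorname{dstab}(I)$ is the smallest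 integer $t_0\ge 1$ with $\operatorname{depth} R/I^t=\operatorname{depth} R/I^{t_0}$ for all $t\ge t_0$. *)

(* Defs.v *)
From HB Require Import structures.
From mathcomp Require Import all_boot all_order all_algebra.
From mathcomp Require Import boolp classical_sets.
From mathcomp Require Import mpoly.

Set Implicit Arguments.
Unset Strict Implicit.
Unset Printing Implicit Defensive.

Import GRing.Theory.

Local Open Scope classical_set_scope.
Local Open Scope ring_scope.

Section Ideals.
Variable R : comNzRingType.
Implicit Types (I J P : set R) (S : set R) (s : seq R).

(* Possibly improper, unlike the library's [idealr_closed]. *)
Definition is_ideal I : Prop :=
  [/\ I 0, (forall x y, I x -> I y -> I (x + y))
    & (forall a x, I x -> I (a * x))].

Definition ideal_gen S : set R := smallest is_ideal S.

Definition ideal_mul I J : set R := ideal_gen [set x * y | x in I & y in J].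

Definition ideal_exp I (t : nat) : set R := iter t (ideal_mul I) setT.

Definition ideal_prod (d : nat) (p : 'I_d -> set R) : set R :=
  \big[ideal_mul/setT]_(i < d) p i.

Definition is_prime_ideal P : Prop :=
  [/\ is_ideal P, ~ P 1 & (forall x y, P (x * y) -> P x \/ P y)].

(* The associated primes of the module R / J: the prime ideals that are the
   annihilator of the class of some f. *)
Definition Ass J : set (set R) :=
  [set P | is_prime_ideal P /\ exists f, P = [set g | J (g * f)]].

(* [s] is a regular sequence on the module R / J, which includes the condition
   (R / J) / s (R / J) <> 0. *)
Definition regular_seq J s : Prop :=
  (forall i, (i < size s)%N -> forall g,
     ideal_gen (J `|` [set` take i s]) (s`_i * g) ->
     ideal_gen (J `|` [set` take i s]) g)
  /\ ideal_gen (J `|` [set` s]) <> setT.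

Definition ring_dvd (g f : R) : Prop := exists h, f = h * g.

(* The gcd is taken in the ring, so that 0 is the only gcd of the empty set. *)
Definition is_gcd S (g : R) : Prop :=
  (forall f, S f -> ring_dvd g f) /\
  (forall h, (forall f, S f -> ring_dvd h f) -> ring_dvd h g).

End Ideals.

(* The smallest t0 >= 1 from which f is constant; 0 (a junk value) if f is not
   eventually constant. *)
Definition stab_index (T : Type) (f : nat -> T) : nat :=
  let stable_from t0 :=
    (1 <= t0)%N /\ forall t, (t0 <= t)%N -> f t = f t0 in
  xget 0%N
    [set t0 | stable_from t0 /\ forall t1, stable_from t1 -> (t0 <= t1)%N].

Section MonomialIdeals.
Variables (K : fieldType) (n : nat).
Implicit Types (I J P : set {mpoly K[n]}) (S : set 'X_{1..n}).

Definition monomials S : set {mpoly K[n]} := [set 'X_[K, m] | m in S].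

Definition monomial_gens I S : Prop := I = ideal_gen (monomials S).

Definition minimal_monomial_gens I S : Prop :=
  monomial_gens I S /\
  (forall S', S' `<=` S -> monomial_gens I S' -> S' = S).

(* G(I), as a set of exponent vectors; meaningful for monomial ideals only. *)
Definition G I : set 'X_{1..n} := xget set0 (minimal_monomial_gens I).

Definition full_supported I : Prop :=
  forall i : 'I_n, exists2 m, G I m & (0 < m i)%N.

Definition polymatroidal (d : nat) I : Prop :=
  (exists2 S, monomial_gens I S & forall m, S m -> mdeg m = d) /\
  (forall u v, G I u -> G I v ->
   forall i : 'I_n, (v i < u i)%N ->
   exists2 j : 'I_n, (u j < v j)%N & I 'X_[(u - U_(i) + U_(j))%MM]).

Definition squarefree_monomial (m : 'X_{1..n}) : Prop :=
  forall i : 'I_n, (m i <= 1)%N.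

Definition matroidal (d : nat) I : Prop :=
  polymatroidal d I /\
  exists2 S, monomial_gens I S & forall m, S m -> squarefree_monomial m.

Definition monomial_prime P : Prop :=
  is_prime_ideal P /\ exists A : set 'I_n, P = ideal_gen [set 'X_i | i in A].

Definition max_ideal : set {mpoly K[n]} := ideal_gen [set 'X_i | i in setT].

(* depth R / J: the largest length of a regular sequence on R / J contained in
   the graded maximal ideal; 0 (by convention) if R / J = 0. *)
Definition depth J : nat :=
  let has_regular_seq k :=
    exists s : seq {mpoly K[n]},
      [/\ size s = k, [set` s] `<=` max_ideal & regular_seq J s] in
  xget 0%N
    [set k | has_regular_seq k /\ forall l, has_regular_seq l -> (l <= k)%N].

Definition astab I : nat := stab_index (fun t => Ass (ideal_exp I t)).

Definition dstab I : nat := stab_index (fun t => depth (ideal_exp I t)).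

End MonomialIdeals.

(* Main.v *)
(* Call two variables adjacent if some basis stays a basis when one of them is
   exchanged for the other; bases have constant degree r_E >= 1 on each connected
   component E of this graph, and parts of different bases on different
   components can be recombined.  Let c be the number of components; then c <= d,
   with equality iff all r_E = 1, i.e. iff I is the product of the primes P_E.

   Multiplying bases (elements of G(I)) along exchange paths produces, for some
   t >= 1, a product g of t bases such that y g / x_E is divisible by a product of
   t bases whenever y lies in the component E with representative x_E.
   Hence (I^t : g / x_E) = P_E, and the c - 1 differences of representatives form a
   regular sequence on R / I^t, modulo which g / x_E is a socle element; so
   depth R / I^t = c - 1.  If c = d, such a g exists for every t, and the ideals
   P_E are the only associated primes of I^t.
   If c < d, then P_E is not associated to the squarefree ideal I when r_E >= 2,
   and one more nonzerodivisor on the quotient of R / I gives depth R / I >= c.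

   That a socle element bounds the length of all regular sequences is proved with
   a Koszul complex. *)

Require Import Defs.
From HB Require Import structures.
From mathcomp Require Import all_boot all_order all_algebra.
From mathcomp Require Import boolp classical_sets.
From mathcomp Require Import mpoly.
From mathcomp Require Import ring zify.

Set Implicit Arguments.
Unset Strict Implicit.
Unset Printing Implicit Defensive.

Import GRing.Theory.

Local Open Scope classical_set_scope.
Local Open Scope ring_scope.

(** * Ideals and regular sequences *)

Section Ideals.
Variable R : comNzRingType.
Implicit Types (I J : set R) (S : set R) (s : seq R).

Lemma is_ideal_gen S : is_ideal (ideal_gen S).
Proof.
split=> [A [[]] //|x y Sx Sy A SA|a x Sx A SA].
  by case: (SA) => [[_ AD _] _]; apply: AD; [exact: Sx|exact: Sy].
by case: (SA) => [[_ _ AM] _]; apply: AM; exact: Sx.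
Qed.

Lemma ideal_gen_id J : is_ideal J -> ideal_gen J = J.
Proof. exact: smallest_id. Qed.

Lemma is_idealB J x y : is_ideal J -> J x -> J y -> J (x - y).
Proof.
by case=> _ JD JM Jx Jy; apply: JD => //; rewrite -mulN1r; apply: JM.
Qed.

Lemma is_ideal_sum J (T : Type) (r : seq T) (P : pred T) (F : T -> R) :
  is_ideal J -> (forall i, P i -> J (F i)) -> J (\sum_(i <- r | P i) F i).
Proof. by case=> J0 JD _ JF; elim/big_rec: _ => // i x Pi; apply/JD/JF. Qed.

Definition adjoin J a := ideal_gen (J `|` [set a]).

Lemma is_ideal_adjoin J a : is_ideal (adjoin J a).
Proof. exact: is_ideal_gen. Qed.

Lemma sub_adjoin J a : J `<=` adjoin J a.
Proof. by move=> x Jx; apply: sub_gen_smallest; left. Qed.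

Lemma adjoin_mem J a b : adjoin J a (b * a).
Proof.
by case: (is_ideal_adjoin J a) => _ _; apply; apply: sub_gen_smallest; right.
Qed.

Lemma adjoinP J a x : is_ideal J ->
  adjoin J a x <-> exists j b, J j /\ x = j + b * a.
Proof.
move=> idJ; split; last first.
  move=> [j [b [Jj ->]]]; case: (is_ideal_adjoin J a) => _ aD _.
  by apply: aD; [exact: sub_adjoin|exact: adjoin_mem].
have [J0 JD JM] := idJ.
apply: (smallest_sub (X := [set x | exists j b, J j /\ x = j + b * a])).
  split; first by exists 0, 0; rewrite mul0r addr0.
  - move=> _ _ [j [b [Jj ->]]] [j' [b' [Jj' ->]]].
    by exists (j + j'), (b + b'); split; [exact: JD|ring].
  - move=> y _ [j [b [Jj ->]]]; exists (y * j), (y * b).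
    by split; [exact: JM|ring].
move=> y [Jy|->]; first by exists y, 0; rewrite mul0r addr0.
by exists 0, 1; rewrite add0r mul1r.
Qed.

Lemma ideal_gen_cons J a s :
  ideal_gen (J `|` [set` a :: s]) = ideal_gen (adjoin J a `|` [set` s]).
Proof.
have H1 := is_ideal_gen (J `|` [set` a :: s]).
have H2 := is_ideal_gen (adjoin J a `|` [set` s]).
apply/seteqP; split; apply: smallest_sub => //.
- move=> x [Jx|/=].
    by apply: sub_gen_smallest; left; exact: sub_adjoin.
  rewrite inE => /orP[/eqP->|xs]; apply: sub_gen_smallest; last by right.
  by left; apply: sub_gen_smallest; right.
- move=> x [|xs]; last first.
    by apply: sub_gen_smallest; right; rewrite /= inE xs orbT.
  apply: smallest_sub => // y [Jy|->]; apply: sub_gen_smallest; first by left.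
  by right; rewrite /= inE eqxx.
Qed.

Lemma ideal_gen_nil J : is_ideal J -> ideal_gen (J `|` [set` [::]]) = J.
Proof.
move=> idJ; rewrite (_ : [set` [::]] = set0) ?setU0 ?ideal_gen_id //.
by apply/seteqP; split=> x //=.
Qed.

Lemma regular_seq_nil J : is_ideal J -> regular_seq J [::] <-> J <> setT.
Proof.
move=> idJ; split=> [[_]|JT]; first by rewrite ideal_gen_nil.
by split=> //; rewrite ideal_gen_nil.
Qed.

(** Trades the prefixes [take i s] for a base ideal that grows with each element, which permits
    induction on the sequence. *)
Lemma regular_seq_cons J a s : is_ideal J ->
  regular_seq J (a :: s) <->
  (forall g, J (a * g) -> J g) /\ regular_seq (adjoin J a) s.
Proof.
move=> idJ; split.
  move=> [reg prop]; split.
    by move=> g; have := reg 0 erefl g; rewrite /= ideal_gen_nil.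
  split; last by rewrite -ideal_gen_cons.
  by move=> i si g; have := reg i.+1 si g; rewrite /= ideal_gen_cons.
move=> [reg [regs prop]]; split; last by rewrite ideal_gen_cons.
case=> [_|i si] g; first by rewrite /= ideal_gen_nil //; exact: reg.
by rewrite [take _ _]/= ideal_gen_cons; exact: regs.
Qed.

End Ideals.

(** * Koszul cochains on words *)

Section Koszul.
Variables (R : comNzRingType) (T : finType) (x : T -> R).
Implicit Types (J : set R) (s : seq R) (f g : seq T -> R) (A : seq T).

(* The Koszul differential on cochains that are indexed by arbitrary words
   instead of alternating in their letters: the entry at [a_0 ... a_k] is the
   sum of [(-1) ^ i * x a_i * f (a_0 ... a_k with a_i deleted)].  With this
   recursion the identity [x a * f = (d (i_a f)) + i_a (d f)], where [i_a]
   prepends the letter [a], holds by definition. *)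
Fixpoint kdiff f A : R :=
  if A is a :: A' then x a * f A' - kdiff (fun B => f (a :: B)) A' else 0.

Lemma kdiffB f g A : kdiff (fun B => f B - g B) A = kdiff f A - kdiff g A.
Proof.
elim: A f g => [|a A IH] f g /=; first by rewrite subr0.
by rewrite (IH (fun B => f (a :: B)) (fun B => g (a :: B))); ring.
Qed.

Lemma kdiffZ c f A : kdiff (fun B => c * f B) A = c * kdiff f A.
Proof.
elim: A f => [|a A IH] f /=; first by rewrite mulr0.
by rewrite (IH (fun B => f (a :: B))); ring.
Qed.

Lemma kdiff_eq f g A :
  (forall B, (size B).+1 = size A -> f B = g B) -> kdiff f A = kdiff g A.
Proof.
elim: A f g => [|a A IH] f g //= fg; rewrite fg // (IH _ (fun B => g (a :: B))) //.
by move=> B BA; rewrite fg //= BA.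
Qed.

Lemma kdiff_sum (c : T -> R) (F : T -> seq T -> R) A :
  kdiff (fun B => \sum_b c b * F b B) A = \sum_b c b * kdiff (F b) A.
Proof.
elim: A F => [|a A IH] F /=; first by rewrite big1 // => b _; rewrite mulr0.
rewrite (IH (fun b B => F b (a :: B))) mulr_sumr -sumrB.
by apply: eq_bigr => b _; ring.
Qed.

Lemma kdiffK f A : kdiff (kdiff f) A = 0.
Proof.
elim: A f => [|a A IH] f //=.
rewrite kdiffB kdiffZ (IH (fun B => f (a :: B))); ring.
Qed.

Lemma kdiff_ideal J f A : is_ideal J ->
  (forall B, (size B).+1 = size A -> J (f B)) -> J (kdiff f A).
Proof.
move=> idJ; have [J0 _ JM] := idJ.
elim: A f => [|a A IH] f //= Jf; apply: is_idealB => //.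
  by apply: JM; apply: Jf.
by apply: IH => B BA; apply: Jf; rewrite /= BA.
Qed.

(* The Koszul cohomology of [R / J] vanishes in degrees [<= k]. *)
Definition kexact J k := forall j, (j <= k)%N ->
  forall f, (forall A, size A = j.+1 -> J (kdiff f A)) ->
  exists g, forall A, size A = j -> J (f A - kdiff g A).

(* On cohomology an element of the ideal generated by the [x b] acts as [0],
   by the homotopy [h] below, and the first element of [s] acts injectively as
   soon as the cohomology of [R / (J + (a))] vanishes one degree lower. *)
Lemma regular_kexact J s k : is_ideal J -> regular_seq J s ->
  (forall y, y \in s -> exists c : T -> R, y = \sum_b c b * x b) ->
  (k < size s)%N -> kexact J k.
Proof.
elim: s J k => // a s IH J k idJ /regular_seq_cons-/(_ idJ)[rega regs] sm ks.
have [J0 JD JM] := idJ.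
have [c ac] := sm a (mem_head _ _).
case=> [_|j jk] f cyc.
  exists (fun=> 0) => -[|//] _ /=; rewrite subr0.
  (* In degree 0 a cocycle is killed by every [x b] modulo [J], hence by [a]. *)
  apply: rega; rewrite ac mulr_suml; apply: is_ideal_sum => // b _.
  by rewrite -mulrA; apply: JM; have := cyc [:: b] erefl; rewrite /= subr0.
pose h A := \sum_b c b * f (b :: A).
have dh A : kdiff h A = a * f A - \sum_b c b * kdiff f (b :: A).
  rewrite kdiff_sum ac mulr_suml -sumrB; apply: eq_bigr => b _ /=; ring.
have [||||g hg] := IH (adjoin J a) k.-1 (is_ideal_adjoin _ _) regs _ _ j _ h.
- by move=> y ys; apply: sm; rewrite inE ys orbT.
- by case: k ks jk.
- by case: k ks jk.
- move=> A Aj; rewrite dh; apply: (is_idealB (is_ideal_adjoin _ _)).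
    by rewrite mulrC; exact: adjoin_mem.
  apply: sub_adjoin; apply: is_ideal_sum => // b _; apply: JM.
  by apply: cyc; rewrite /= Aj.
have {}hg A : exists jb : R * R, size A = j ->
    J jb.1 /\ h A - kdiff g A = jb.1 + jb.2 * a.
  case: (pselect (size A = j)) => [/hg|nA]; last by exists (0, 0).
  by case/(adjoinP _ _ idJ).1 => u [b]; exists (u, b).
have {}[w hw] := choice hg.
(* Applying [kdiff] to [h - kdiff g = w.1 + w.2 * a] removes [g] and puts [a * (f - kdiff w.2)] into
   [J]; as [a] is regular, [w.2] is a primitive of [f]. *)
exists (fun A => (w A).2) => A Aj; apply: rega.
have E : kdiff (fun B => h B - kdiff g B) A =
         kdiff (fun B => (w B).1 + (w B).2 * a) A.
  by apply: kdiff_eq => B; rewrite Aj => -[/hw[]].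
rewrite kdiffB kdiffK subr0 dh in E.
have -> : a * (f A - kdiff (fun A => (w A).2) A) =
   \sum_b c b * kdiff f (b :: A) + kdiff (fun B => (w B).1) A.
  rewrite mulrBr -kdiffZ -[a * f A](subrK (\sum_b c b * kdiff f (b :: A))) E.
  rewrite addrAC addrC -kdiffB; congr (_ + _).
  by apply: kdiff_eq => B _; ring.
apply: JD; last by apply: kdiff_ideal => // B; rewrite Aj => -[/hw[]].
by apply: is_ideal_sum => // b _; apply/JM/cyc; rewrite /= Aj.
Qed.

(** The long exact sequence of multiplication by [a], unrolled. If [kdiff h = w1 + w2 * a] with [w1]
    in [J], then [w2] is a cocycle modulo [J], say [kdiff q]. Now [h - a * q] is a cocycle modulo
    [J], and a primitive of it is a primitive of [h] modulo [a]. *)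
Lemma kexact_adjoin J a k : is_ideal J -> (forall y, J (a * y) -> J y) ->
  kexact J k.+1 -> kexact (adjoin J a) k.
Proof.
move=> idJ rega exJ j jk h cyc; have [J0 JD JM] := idJ.
have {}cyc A : exists jb : R * R, size A = j.+1 ->
    J jb.1 /\ kdiff h A = jb.1 + jb.2 * a.
  case: (pselect (size A = j.+1)) => [/cyc|nA]; last by exists (0, 0).
  by case/(adjoinP _ _ idJ).1 => u [b]; exists (u, b).
have {cyc}[w hw] := choice cyc.
have [|q hq] := exJ j.+1 jk (fun A => (w A).2).
  move=> A Aj; apply: rega; rewrite -kdiffZ.
  have E : kdiff (kdiff h) A = kdiff (fun B => (w B).1 - - (w B).2 * a) A.
    by apply: kdiff_eq => B; rewrite Aj => -[/hw[_ ->]]; ring.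
  rewrite kdiffK kdiffB in E.
  rewrite (_ : kdiff _ A = - kdiff (fun B => (w B).1) A).
    rewrite -mulN1r; apply: JM.
    by apply: kdiff_ideal => // B; rewrite Aj => -[/hw[]].
  have -> : kdiff (fun B => a * (w B).2) A = - 1 * kdiff (fun B => - (w B).2 * a) A.
    by rewrite -kdiffZ; apply: kdiff_eq => B _; ring.
  by move/eqP: E; rewrite eq_sym subr_eq0 => /eqP->; ring.
have [A Aj|r hr] := exJ j (leqW jk) (fun A => h A - a * q A).
  rewrite kdiffB kdiffZ; have [J1 ->] := hw _ Aj.
  rewrite -addrA; apply: JD => //.
  by rewrite mulrC -mulrBr; apply: JM; apply: hq.
exists r => A Aj.
rewrite -[h A](subrK (a * q A)) addrAC mulrC.
case: (is_ideal_adjoin J a) => _ aD _; apply: aD; last exact: adjoin_mem.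
by apply: sub_adjoin; rewrite (mulrC (q A)); exact: hr.
Qed.

(** A degree 0 cochain is a single element and every coboundary there is 0, so a nonzero socle class
    is not a coboundary. *)
Lemma kexact_socle J u : is_ideal J -> ~ J u -> (forall b, J (x b * u)) ->
  ~ kexact J 0.
Proof.
move=> idJ Ju soc /(_ 0 (leqnn _) (fun=> u))[|g /(_ [::] erefl)] /=.
  by move=> [|b [|//]] //= _; rewrite subr0.
by rewrite subr0.
Qed.

(* [u] is a socle element of the quotient by [s], hence a nonzero cohomology
   class of degree [0] there; [kexact_adjoin] lifts it to degree [size s] over
   [R / J]. *)
Lemma regular_size_le J s s' u : is_ideal J ->
  regular_seq J s -> ~ ideal_gen (J `|` [set` s]) u ->
  (forall b, ideal_gen (J `|` [set` s]) (x b * u)) ->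
  regular_seq J s' ->
  (forall y, y \in s' -> exists c : T -> R, y = \sum_b c b * x b) ->
  (size s' <= size s)%N.
Proof.
move=> idJ regs nu soc regs' s'm; rewrite leqNgt; apply/negP => ss'.
have {s'm regs' ss'} := regular_kexact idJ regs' s'm ss'.
elim: s J idJ regs nu soc => [|a s IH] J idJ.
  by rewrite ideal_gen_nil // => _ nu soc; exact: (kexact_socle idJ nu soc).
rewrite ideal_gen_cons => /regular_seq_cons-/(_ idJ)[rega regs] nu soc exJ.
apply: (IH (adjoin J a)) => //; first exact: is_ideal_adjoin.
exact: kexact_adjoin.
Qed.

End Koszul.

(** * Koszul cohomology in top degree *)

Section KoszulTop.
Variables (R : comNzRingType) (n : nat) (x : 'I_n -> R).
Implicit Types (A : seq 'I_n).

Definition word_entry A i (j : 'I_n) : R := (onth A i == Some j)%:R.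

(** On words of length [n] this is the sign of a permutation of the letters, and 0 if a letter is
    repeated: the top exterior form as a cochain. *)
Definition word_det A : R := \det (\matrix_(i < n, j < n) word_entry A i j).

Lemma word_entry_del A i k j :
  word_entry (take i A ++ drop i.+1 A) k j = word_entry A (bump i k) j.
Proof.
rewrite /word_entry; congr ((_ == _)%:R).
elim: A i k => [|a A IH] [|i] k; rewrite ?onth0n //= ?drop0 //.
by case: k => [|k] //=; rewrite bumpS IH.
Qed.

Lemma kdiffE f A : kdiff x f A = \sum_(i < size A)
  (-1) ^+ i * (\sum_j x j * word_entry A i j) * f (take i A ++ drop i.+1 A).
Proof.
elim: A f => [|a A IH] f /=; first by rewrite big_ord0.
rewrite big_ord_recl /= drop0 expr0 mul1r IH -sumrN; congr (_ * _ + _).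
  rewrite (bigD1 a) //= /word_entry /= eqxx mulr1 big1 ?addr0 // => j ja.
  by rewrite (inj_eq Some_inj) eq_sym (negPf ja) mulr0.
by apply: eq_bigr => i _; rewrite /= exprS mulN1r !mulNr.
Qed.

(* The sum is the Laplace expansion of the determinant whose first column is a
   combination of the other ones. *)
Lemma kdiff_word_det A : size A = n.+1 -> kdiff x word_det A = 0.
Proof.
move=> sA; rewrite kdiffE sA.
pose N c := \matrix_(i < n.+1, j < n.+1)
  (if unlift ord0 j is Some j' then word_entry A i j'
   else c * \sum_j x j * word_entry A i j).
have NE : \det (N 1) = 0.
  (* A column operation: the right factor puts the combination of the letter columns into the first
     column, which is zero in [N 0]. *)
  have -> : N 1 = N 0 *m \matrix_(i < n.+1, j < n.+1)
     (if unlift ord0 i is Some i' then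
        if unlift ord0 j is Some j' then (i' == j')%:R else x i' else 0).
    apply/matrixP => i j; rewrite !mxE big_ord_recl !mxE !unlift_none mulr0 add0r.
    case: unliftP => [j' ->|->].
      rewrite (bigD1 j') //= !mxE !liftK eqxx mulr1 big1 ?addr0 // => k kj.
      by rewrite !mxE !liftK (negPf kj) mulr0.
    by rewrite mul1r; apply: eq_bigr => k _; rewrite !mxE liftK unlift_none mulrC.
  rewrite det_mulmx (expand_det_col _ ord0) big1 ?mul0r // => i _.
  by rewrite mxE unlift_none !mul0r.
transitivity (\det (N 1)); last exact: NE.
rewrite (expand_det_col _ ord0); apply: eq_bigr => i _.
rewrite mxE unlift_none mul1r /cofactor addn0 mulrA; congr (_ * _).
  by rewrite mulrC.
congr (\det _); apply/matrixP => k l.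
by rewrite !mxE liftK word_entry_del.
Qed.

(** [word_det] is a cocycle with value 1 at [enum 'I_n], whereas coboundaries take values in the
    ideal of the [x i], which lies in [M] together with [J]. *)
Lemma not_kexact_top (J M : set R) : is_ideal J -> is_ideal M -> J `<=` M ->
  (forall i, M (x i)) -> ~ M 1 -> ~ kexact x J n.
Proof.
move=> [J0 _ _] idM JM Mx M1 /(_ n (leqnn _) word_det)[A sA|g].
  by rewrite kdiff_word_det.
move=> /(_ (enum 'I_n) (size_enum_ord n)) /JM H; apply: M1.
have -> : 1 = word_det (enum 'I_n).
  rewrite -(det1 R n); congr (\det _); apply/matrixP => i j; rewrite !mxE.
  have -> : word_entry (enum 'I_n) i j = (i == j)%:R.
    rewrite /word_entry onthE (nth_map i) ?size_enum_ord // nth_ord_enum.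
    by rewrite (inj_eq Some_inj).
  by [].
have [_ MD MM] := idM.
rewrite -[word_det _](subrK (kdiff x g (enum 'I_n))); apply: MD => //.
elim: (enum 'I_n) g {H} => [|a A IH] g /=; first by case: idM.
by apply: is_idealB => //; rewrite mulrC; apply: MM.
Qed.

(** A bound on all regular sequences that requires no socle element. *)
Lemma regular_size_bound (J M : set R) (s : seq R) :
  is_ideal J -> is_ideal M -> J `<=` M ->
  (forall i, M (x i)) -> ~ M 1 -> regular_seq J s ->
  (forall y, y \in s -> exists c : 'I_n -> R, y = \sum_b c b * x b) ->
  (size s <= n)%N.
Proof.
move=> idJ idM JM Mx M1 regs sx; rewrite leqNgt; apply/negP => ns.
exact: (not_kexact_top idJ idM JM Mx M1 (regular_kexact idJ regs sx ns)).
Qed.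

End KoszulTop.

(** * Monomial ideals *)

Section MonomialIdealTheory.
Variables (K : fieldType) (n : nat).
Implicit Types (I J : set {mpoly K[n]}) (S U V : set 'X_{1..n}).
Implicit Types (m : 'X_{1..n}) (f g : {mpoly K[n]}).

(** For up-closed [U], the monomial ideal with exponent set [U], described by supports so that
    membership is checked monomial by monomial. *)
Definition mideal U : set {mpoly K[n]} := [set f | forall m, m \in msupp f -> U m].

Definition up_closed U := forall m m', U m -> (m <= m')%MM -> U m'.

Definition up S : set 'X_{1..n} := [set m | exists2 s, S s & (s <= m)%MM].

Lemma up_closed_up S : up_closed (up S).
Proof.
by move=> m m' [s Ss sm] mm'; exists s => //; exact: lepm_trans mm'.
Qed.

Lemma mideal0 U : mideal U 0.
Proof. by move=> m; rewrite msupp0. Qed.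

Lemma is_ideal_mideal U : up_closed U -> is_ideal (mideal U).
Proof.
move=> upU; split=> [|f g Uf Ug m /msuppD_le|f g Ug m /msuppM_le].
- exact: mideal0.
- by rewrite mem_cat => /orP[/Uf|/Ug].
- by move=> /allpairsP[[m1 m2] /= [_ /Ug Um ->]]; apply: upU Um (lem_addl _ _).
Qed.

Lemma midealX U m : mideal U 'X_[m] <-> U m.
Proof.
split=> [|Um m']; first by apply; rewrite msuppX mem_head.
by rewrite msuppX inE => /eqP->.
Qed.

Lemma midealMX U m f : mideal U (f * 'X_[m]) <-> mideal [set k | U (k + m)%MM] f.
Proof.
split=> Uf k.
  rewrite mcoeff_msupp -(mcoeffMX _ m) -mcoeff_msupp => /Uf /=.
  by rewrite addmC.
rewrite (perm_mem (msuppMX _ _)) => /mapP[k' /Uf Uk ->].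
by rewrite addmC.
Qed.

Lemma sub_mideal U J : is_ideal J -> (forall m, U m -> J 'X_[m]) ->
  mideal U `<=` J.
Proof.
move=> idJ UJ f Uf; rewrite [f]mpolyE big_seq.
apply: is_ideal_sum => // m /Uf Um; rewrite -mul_mpolyC.
by case: idJ => _ _; apply; exact: UJ.
Qed.

Lemma eq_mideal U V : mideal U = mideal V -> U = V.
Proof.
move=> UV; apply/seteqP; split=> m Um.
  by apply/midealX; rewrite -UV; apply/midealX.
by apply/midealX; rewrite UV; apply/midealX.
Qed.

Lemma ideal_gen_monomials S : ideal_gen (@monomials K n S) = mideal (up S).
Proof.
apply/seteqP; split.
  apply: smallest_sub; first exact/is_ideal_mideal/up_closed_up.
  by move=> _ [m Sm <-]; apply/midealX; exists m => //; exact: lepm_refl.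
apply: sub_mideal; first exact: is_ideal_gen.
move=> m [s Ss sm]; rewrite -(submK sm) mpolyXD.
case: (is_ideal_gen (@monomials K n S)) => _ _; apply.
by apply: sub_gen_smallest; exists s.
Qed.

Definition antichain S := forall s s', S s -> S s' -> (s <= s')%MM -> s = s'.

Lemma antichain_G S I : antichain S -> I = mideal (up S) -> G I = S.
Proof.
move=> acS IS; apply: xget_unique.
  split; first by rewrite /monomial_gens ideal_gen_monomials.
  move=> S' S'S; rewrite /monomial_gens ideal_gen_monomials IS => /eq_mideal upE.
  apply/seteqP; split=> // m Sm.
  have [s S's sm] : up S' m by rewrite -upE; exists m => //; exact: lepm_refl.
  by rewrite -(acS _ _ (S'S _ S's) Sm sm).
move=> S' [IS' minS'].
(* Each [m] in [S] lies above some [s] in [S'], which lies above some [s'] in [S]; the antichain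
   property gives [s' = m], so [s = m]. *)
have SS' : S `<=` S'.
  move=> m Sm; have [s S's sm] : up S' m.
    have := IS'; rewrite /monomial_gens ideal_gen_monomials IS => /eq_mideal <-.
    by exists m => //; exact: lepm_refl.
  have [s' Ss' s's] : up S s.
    have := IS'; rewrite /monomial_gens ideal_gen_monomials IS => /eq_mideal ->.
    by exists s => //; exact: lepm_refl.
  have E := acS _ _ Ss' Sm (lepm_trans s's sm).
  rewrite E in s's; suff -> : m = s by [].
  by apply/mnmP => i; apply/eqP; rewrite eqn_leq (mnm_lepP s's) (mnm_lepP sm).
by rewrite (minS' S SS') //  /monomial_gens ideal_gen_monomials.
Qed.

Lemma setT_mideal : mideal setT = setT.
Proof. by apply/seteqP; split. Qed.

Definition msumset U V : set 'X_{1..n} :=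
  [set m | exists u v, [/\ U u, V v & m = (u + v)%MM]].

Lemma up_closed_msumset U V : up_closed V -> up_closed (msumset U V).
Proof.
move=> upV m m' [u [v [Uu Vv ->]]] uvm; exists u, (v + (m' - (u + v)))%MM.
split=> //; first by apply: upV Vv _; exact: lem_addr.
by rewrite addmA addmC submK.
Qed.

Lemma ideal_mul_mideal U V : up_closed V ->
  ideal_mul (mideal U) (mideal V) = mideal (msumset U V).
Proof.
move=> upV; apply/seteqP; split.
  apply: smallest_sub; first exact/is_ideal_mideal/up_closed_msumset.
  move=> _ [f Uf] [g Vg] <- m /msuppM_le /allpairsP[[u v] /= [/Uf Uu /Vg Vv ->]].
  by exists u, v.
apply: sub_mideal; first exact: is_ideal_gen.
move=> _ [u [v [Uu Vv ->]]]; rewrite mpolyXD; apply: sub_gen_smallest.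
exists 'X_[u]; first exact/midealX.
by exists 'X_[v]; first exact/midealX.
Qed.

(** * Monomial primes *)

Definition restrict (P : pred 'X_{1..n}) f : {mpoly K[n]} :=
  \sum_(m <- msupp f | P m) f@_m *: 'X_[m].

Lemma mcoeff_restrict P f m : (restrict P f)@_m = if P m then f@_m else 0.
Proof.
rewrite /restrict big_mkcond raddf_sum /=.
under eq_bigr => k _ do rewrite (fun_if (mcoeff m)) mcoeffZ mcoeffX mcoeff0.
case: (boolP (m \in msupp f)) => mf.
  rewrite (bigD1_seq m) ?msupp_uniq //= big1 => [|k km]; last first.
    by rewrite (negPf km) mulr0 if_same.
  by rewrite eqxx mulr1 addr0.
rewrite (memN_msupp_eq0 mf) if_same big_seq big1 // => k kf.
have := memPnC mf _ kf; rewrite eq_sym => /negPf ->.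
by rewrite mulr0 if_same.
Qed.

Lemma msupp_restrict P f m : (m \in msupp (restrict P f)) = P m && (m \in msupp f).
Proof. by rewrite !mcoeff_msupp mcoeff_restrict; case: (P m); rewrite ?eqxx. Qed.

Lemma msupp_restrictB P f m :
  (m \in msupp (f - restrict P f)) = ~~ P m && (m \in msupp f).
Proof.
rewrite !mcoeff_msupp mcoeffB mcoeff_restrict.
by case: (P m); rewrite ?subrr ?eqxx ?subr0.
Qed.

Definition pvars (A : set 'I_n) : set 'X_{1..n} :=
  [set m | exists2 i, A i & (0 < m i)%N].

Lemma up_closed_pvars A : up_closed (pvars A).
Proof.
by move=> m m' [i Ai mi] /mnm_lepP/(_ i) mm'; exists i => //; exact: leq_trans mm'.
Qed.

Lemma ideal_gen_vars (A : set 'I_n) :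
  ideal_gen [set ('X_i : {mpoly K[n]}) | i in A] = mideal (pvars A).
Proof.
have -> : [set ('X_i : {mpoly K[n]}) | i in A] =
          @monomials K n [set U_(i)%MM | i in A].
  apply/seteqP; split=> [_ [i Ai <-]|_ [_ [i Ai <-] <-]]; last by exists i.
  by exists U_(i)%MM => //; exists i.
rewrite ideal_gen_monomials; congr mideal; apply/seteqP; split.
  by move=> m [_ [i Ai <-]]; rewrite lep1mP -lt0n => mi; exists i.
move=> m [i Ai mi]; exists U_(i)%MM; first by exists i.
by rewrite lep1mP -lt0n.
Qed.

Lemma G_vars (A : set 'I_n) : G (mideal (pvars A)) = [set U_(i)%MM | i in A].
Proof.
apply: antichain_G.
  move=> _ _ [i Ai <-] [j Aj <-]; rewrite lep1mP mnm1E eqb0 negbK.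
  by move/eqP->.
congr mideal; apply/seteqP; split.
  move=> m [i Ai mi]; exists U_(i)%MM; first by exists i.
  by rewrite lep1mP -lt0n.
by move=> m [_ [i Ai <-]]; rewrite lep1mP -lt0n => mi; exists i.
Qed.

(** Drop from [f] and [g] all monomials that involve a variable of [A]. The product of the rest
    still lies in the ideal but has no monomial involving [A], so it is 0, and one factor is 0. *)
Lemma mideal_pvars_prime (A : set 'I_n) : is_prime_ideal (mideal (pvars A)).
Proof.
have idP := is_ideal_mideal (@up_closed_pvars A).
split=> //.
  by move=> /(_ 0%MM); rewrite msupp1 mem_head => /(_ erefl)[i _]; rewrite mnm0E.
move=> f g Pfg; pose no_A m := `[< ~ pvars A m >].
have restrictP h : mideal (pvars A) (h - restrict no_A h).
  by move=> m; rewrite msupp_restrictB => /andP[/asboolPn/contrapT].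
have P0 : mideal (pvars A) (restrict no_A f * restrict no_A g).
  rewrite (_ : _ * _ = f * g - (g * (f - restrict no_A f) +
     restrict no_A f * (g - restrict no_A g))); last by ring.
  have [_ PD PM] := idP; apply: (is_idealB idP) => //.
  by apply: PD; apply: PM; exact: restrictP.
have /eqP : restrict no_A f * restrict no_A g = 0.
  apply/msuppnil0/eqP; rewrite -size_eq0 size_eq0; apply/eqP.
  case E : (msupp _) => [//|m s].
  have mm : m \in msupp (restrict no_A f * restrict no_A g) by rewrite E mem_head.
  have [i Ai] := P0 _ mm; move: mm => /msuppM_le /allpairsP[[u v] /=].
  rewrite !msupp_restrict => -[/andP[/asboolP Nu _] /andP[/asboolP Nv _] ->].
  rewrite mnmDE addn_gt0 => /orP[ui|vi].
    by case: Nu; exists i.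
  by case: Nv; exists i.
rewrite mulf_eq0 => /orP[]/eqP E; [left|right].
  by have := restrictP f; rewrite E subr0.
by have := restrictP g; rewrite E subr0.
Qed.

Lemma max_ideal_comb f : @max_ideal K n f -> exists c, f = \sum_b c b * 'X_b.
Proof.
apply: (smallest_sub (X := [set f | exists c, f = \sum_b c b * 'X_b])).
  split=> [|_ _ [c ->] [c' ->]|a _ [c ->]].
  - by exists (fun=> 0); rewrite big1 // => b _; rewrite mul0r.
  - exists (fun b => c b + c' b); rewrite -big_split; apply: eq_bigr => b _.
    by rewrite mulrDl.
  - exists (fun b => a * c b); rewrite mulr_sumr; apply: eq_bigr => b _.
    by rewrite mulrA.
move=> _ [i _ <-]; exists (fun b => (b == i)%:R).
rewrite (bigD1 i) //= eqxx mul1r big1 ?addr0 // => b bi.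
by rewrite (negPf bi) mul0r.
Qed.

Lemma max_idealE : @max_ideal K n = mideal (pvars setT).
Proof. exact: ideal_gen_vars. Qed.

End MonomialIdealTheory.

(** * Identifying variables *)

Section Gluing.
Variables (K : fieldType) (n : nat).
Implicit Types (I J : set {mpoly K[n]}) (S U V : set 'X_{1..n}).
Implicit Types (m : 'X_{1..n}) (f g : {mpoly K[n]}) (h : 'I_n -> 'I_n).

Lemma mcoeffXM i f m :
  ('X_i * f)@_m = if (0 < m i)%N then f@_(m - U_(i)) else 0.
Proof.
case: ifPn => mi.
  have le : (U_(i) <= m)%MM by rewrite lep1mP -lt0n.
  by rewrite -[in LHS](submK le) mulrC addmC mcoeffMX.
apply: memN_msupp_eq0; rewrite mulrC (perm_mem (msuppMX _ _)).
by apply: contra mi => /mapP[k _ ->]; rewrite mnmDE mnm1E eqxx.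
Qed.

(** Let [m] be a monomial of [f] outside [V]. Then [m + U_(b)] is outside [V] and must cancel in the
    product, which needs the monomial [m + U_(b) - U_(z)] of [f], again outside [V]. Repetition
    raises the [b]-degree beyond any bound. *)
Lemma mideal_subX_reg V b z f : b != z -> up_closed V ->
  (forall m, V (m + U_(b))%MM -> V m) ->
  mideal V (('X_b - 'X_z) * f) -> mideal V f.
Proof.
move=> bz upV Vb VF m mf; apply: contrapT => Vm.
suff H k : exists m', [/\ m' \in msupp f, ~ V m' & (k <= m' b)%N].
  have [m' [m'f _]] := H (msize f).
  apply/negP; rewrite -ltnNge; apply: leq_ltn_trans (msize_mdeg_lt m'f).
  by rewrite mdegE (bigD1 b) //= leq_addr.
elim: k => [|k [m' [m'f Vm' km']]]; first by exists m.
have c0 : (('X_b - 'X_z) * f)@_(m' + U_(b)) = 0.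
  by apply: memN_msupp_eq0; apply/negP => /VF /Vb.
have bE : (m' + U_(b))%MM b = (m' b).+1 by rewrite mnmDE mnm1E eqxx addn1.
move: c0; rewrite mulrBl mcoeffB !mcoeffXM bE /= addmK.
have zE : (m' + U_(b))%MM z = m' z by rewrite mnmDE mnm1E (negPf bz) addn0.
rewrite zE; case: ifPn => m'z; last first.
  by move/eqP; rewrite subr0 mcoeff_eq0 m'f.
move/eqP; rewrite subr_eq0 => /eqP E.
have le : (U_(z) <= m' + U_(b))%MM by rewrite lep1mP zE -lt0n.
exists (m' + U_(b) - U_(z))%MM; split.
- by rewrite mcoeff_msupp -E -mcoeff_msupp.
- move=> Vm''; apply/Vm'/Vb; rewrite -(submK le).
  by apply: upV Vm'' (lem_addr _ _).
- by rewrite mnmBE bE mnm1E eq_sym (negPf bz) subn0.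
Qed.

Lemma mideal_subX_regI V1 V2 b z f : b != z -> up_closed V1 -> up_closed V2 ->
  (forall m, V1 (m + U_(b))%MM -> V1 m) ->
  (forall m, V2 (m + U_(z))%MM -> V2 m) ->
  mideal (V1 `&` V2) (('X_b - 'X_z) * f) -> mideal (V1 `&` V2) f.
Proof.
move=> bz up1 up2 V1b V2z VF m mf; split.
  by apply: (mideal_subX_reg bz up1 V1b _ mf) => k /VF[].
rewrite eq_sym in bz; apply: (mideal_subX_reg (f := f) bz up2 V2z _ mf).
move=> k; rewrite -opprB mulNr (perm_mem (msuppN _)).
by case/VF.
Qed.

Definition mnm_map h m : 'X_{1..n} := (\sum_i U_(h i) *+ m i)%MM.

Lemma mnm_mapE h m j : mnm_map h m j = (\sum_(i | h i == j) m i)%N.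
Proof.
rewrite /mnm_map mnm_sumE [RHS]big_mkcond; apply: eq_bigr => i _.
by rewrite mulmnE mnm1E; case: eqP => _; rewrite ?mul1n ?mul0n.
Qed.

Lemma mnm_mapD h m1 m2 : mnm_map h (m1 + m2) = (mnm_map h m1 + mnm_map h m2)%MM.
Proof.
apply/mnmP => j; rewrite mnmDE !mnm_mapE -big_split; apply: eq_bigr => i _.
by rewrite mnmDE.
Qed.

Lemma mnm_map_le h m1 m2 : (m1 <= m2)%MM -> (mnm_map h m1 <= mnm_map h m2)%MM.
Proof. by move=> le; rewrite -(submK le) mnm_mapD lem_addl. Qed.

Lemma mnm_map1 h i : mnm_map h U_(i) = U_(h i)%MM.
Proof.
apply/mnmP => j; rewrite mnm_mapE mnm1E; case: eqP => hi.
  rewrite (bigD1 i) ?hi //= mnm1E eqxx big1 // => k /andP[_ ki].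
  by rewrite mnm1E eq_sym (negPf ki).
rewrite big1 // => k /eqP hk; rewrite mnm1E; case: eqP => // ik.
by case: hi; rewrite ik.
Qed.

Lemma mdeg_mnm_map h m : mdeg (mnm_map h m) = mdeg m.
Proof.
rewrite /mnm_map mdeg_sum mdegE; apply: eq_bigr => i _.
by rewrite mdegMn mdeg1 mul1n.
Qed.

Lemma mnm_map_comp h h' m : (forall i, h' (h i) = h' i) ->
  mnm_map h' (mnm_map h m) = mnm_map h' m.
Proof.
move=> hh; apply/mnmP => j; rewrite !mnm_mapE.
under eq_bigr do rewrite mnm_mapE.
rewrite (exchange_big_dep (fun i => h' i == j)) /=; last first.
  by move=> i k /eqP hi /eqP hk; rewrite -(hh k) hk hi.
apply: eq_bigr => k /eqP hk; rewrite (big_pred1 (h k)) // => i /=.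
case: (eqVneq i (h k)) => [->|ik]; first by rewrite hh hk !eqxx.
by rewrite andbF.
Qed.

Lemma mnm_map_id h m : (forall i, h i = i) -> mnm_map h m = m.
Proof.
move=> hi; apply/mnmP => j; rewrite mnm_mapE (big_pred1 j) // => i.
by rewrite hi.
Qed.

Definition var_map h : {mpoly K[n]} -> {mpoly K[n]} :=
  mmap (@mpolyC n K) (fun i => 'X_(h i)).

HB.instance Definition _ h := GRing.RMorphism.on (var_map h).

Lemma var_mapX h m : var_map h 'X_[m] = 'X_[mnm_map h m].
Proof.
rewrite /var_map mmapX /mmap1 /mnm_map -mprodXnE //.
Qed.

Lemma var_mapZ h c f : var_map h (c *: f) = c *: var_map h f.
Proof. by rewrite /var_map mmapZ mul_mpolyC. Qed.

Lemma is_ideal_var_map h J : is_ideal J -> is_ideal [set f | J (var_map h f)].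
Proof.
move=> [J0 JD JM]; split=> [|f g Jf Jg|f g Jg] /=; first by rewrite raddf0.
  by rewrite raddfD; apply: JD.
by rewrite rmorphM; apply: JM.
Qed.

Lemma mideal_var_map h V f : mideal V f ->
  mideal (up (mnm_map h @` V)) (var_map h f).
Proof.
move=> Vf.
have idJ := is_ideal_var_map h (is_ideal_mideal K (@up_closed_up n (mnm_map h @` V))).
apply: (sub_mideal idJ _ Vf) => m Vm /=.
rewrite var_mapX; apply/midealX; exists (mnm_map h m); last exact: lepm_refl.
by exists m.
Qed.

Lemma sub_var_map h J f : is_ideal J -> (forall i, J ('X_i - 'X_(h i))) ->
  J (f - var_map h f).
Proof.
move=> idJ Jh; have [J0 JD JM] := idJ.
have JX m : J ('X_[m] - 'X_[mnm_map h m]).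
  elim: {m}(mdeg m) {-2}m (erefl (mdeg m)) => [|d IH] m md.
    move/eqP: md; rewrite mdeg_eq0 => /eqP->.
    by rewrite -var_mapX mpolyX0 rmorph1 subrr.
  have [i mi] : exists i, (0 < m i)%N.
    apply: contrapT => nm; suff E : m = 0%MM by rewrite E mdeg0 in md.
    apply/mnmP => i; rewrite mnm0E; apply/eqP; rewrite -leqn0 leqNgt.
    by apply/negP => mi; apply: nm; exists i.
  have le : (U_(i) <= m)%MM by rewrite lep1mP -lt0n.
  have dE : mdeg (m - U_(i)) = d.
    by move: md; rewrite -{1}(submK le) mdegD mdeg1 addn1 => -[].
  rewrite -(submK le) mnm_mapD mnm_map1 !mpolyXD.
  set u := 'X_[m - _]; set v := 'X_[mnm_map _ _].
  rewrite (_ : _ - _ = 'X_i * (u - v) + v * ('X_i - 'X_(h i))); last by ring.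
  by apply: JD; apply: JM => //; exact: IH.
have -> : f - var_map h f =
    \sum_(m <- msupp f) f@_m *: ('X_[m] - 'X_[mnm_map h m]).
  under eq_bigr do rewrite scalerBr; rewrite sumrB -mpolyE; congr (_ - _).
  rewrite {1}[f]mpolyE raddf_sum; apply: eq_bigr => m _ /=.
  by rewrite var_mapZ var_mapX.
by apply: is_ideal_sum => // m _; rewrite -mul_mpolyC; exact: JM.
Qed.

(* The preimage of the monomial ideal [U] of the quotient ring in which [X_i]
   and [X_(h i)] are identified. *)
Definition glue h U : set {mpoly K[n]} :=
  [set f | mideal (up (mnm_map h @` U)) (var_map h f)].

Lemma is_ideal_glue h U : is_ideal (glue h U).
Proof. exact/is_ideal_var_map/is_ideal_mideal/up_closed_up. Qed.

Lemma glue_id h U : up_closed U -> (forall i, h i = i) -> glue h U = mideal U.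
Proof.
move=> upU hi.
have -> : mideal U = mideal (up (mnm_map h @` U)) :> set {mpoly K[n]}.
  congr mideal; apply/seteqP; split=> m; last first.
    by move=> [_ [u Uu <-]]; rewrite mnm_map_id //; exact: upU.
  by move=> Um; exists m; [exists m; rewrite ?mnm_map_id|exact: lepm_refl].
have id0 : is_ideal [set 0 : {mpoly K[n]}].
  by split=> [|x y -> ->|a x ->]; rewrite /= ?addr0 ?mulr0.
suff E f : f = var_map h f by apply/seteqP; split=> f; rewrite /glue /= -E.
apply/eqP; rewrite -subr_eq0; apply/eqP.
by apply: (sub_var_map f id0) => i; rewrite hi /= subrr.
Qed.

Lemma glue_prop h U : ~ U 0%MM -> ~ glue h U 1.
Proof.
move=> U0; rewrite /glue /= rmorph1 -mpolyX0 => /midealX[_ [u Uu <-]] le.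
apply: U0; suff <- : u = 0%MM by [].
apply/eqP; rewrite -mdeg_eq0 -(mdeg_mnm_map h) mdeg_eq0.
apply/eqP/mnmP => i; rewrite mnm0E; apply/eqP; rewrite -leqn0.
by have /mnm_lepP/(_ i) := le; rewrite mnm0E.
Qed.

Definition merge_into z (L : seq 'I_n) i := if i \in L then z else i.

(** Imposing [X_b = X_z] on the glued quotient merges one more variable. Both inclusions replace a
    polynomial by its image under a merging, the difference lying in the target ideal. *)
Lemma adjoin_glue U (z b : 'I_n) (L : seq 'I_n) : z \notin L -> b \notin L -> b != z ->
  adjoin (glue (merge_into z L) U) ('X_b - 'X_z) =
  glue (merge_into z (b :: L)) U.
Proof.
move=> zL bL bz; set h := merge_into z L; set h' := merge_into z (b :: L).
have hh' i : h' (h i) = h' i.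
  rewrite /h /h' /merge_into; case: (boolP (i \in L)) => [iL|iL].
    by rewrite if_same inE iL orbT.
  by [].
have hh i : h (h i) = h i.
  by rewrite /h /merge_into; case: (boolP (i \in L)) => [|/negPf->] //; rewrite if_same.
have hz : h' z = z by rewrite /h' /merge_into inE eq_sym (negPf bz) (negPf zL).
have hb : h' b = z by rewrite /h' /merge_into mem_head.
have id1 := is_ideal_adjoin (glue h U) ('X_b - 'X_z).
have [_ aD aM] := id1.
apply/seteqP; split.
  apply: smallest_sub; first exact: is_ideal_glue.
  move=> f [gf|->]; last first.
    by rewrite /glue /= raddfB /= !var_mapX !mnm_map1 hz hb subrr; exact: mideal0.
  have -> : f = f - var_map h f + var_map h f by rewrite subrK.
  have [_ gD _] := is_ideal_glue h' U; apply: gD.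
    apply: (@sub_var_map h (glue h' U) f (is_ideal_glue h' U)) => i.
    rewrite /glue /= raddfB /= !var_mapX !mnm_map1 hh' subrr.
    exact: mideal0.
  have H := mideal_var_map (h := h') gf.
  move=> m /H[_ [v [_ [u Uu <-] uv] <-] le].
  exists (mnm_map h' u); first by exists u.
  by apply: lepm_trans le; rewrite -(mnm_map_comp u hh'); exact: mnm_map_le.
move=> f gf.
have sub : forall g, adjoin (glue h U) ('X_b - 'X_z) (g - var_map h' g).
  move=> g; apply: (@sub_var_map h' _ g id1) => i; case: (eqVneq i b) => [->|ib].
    by have := @adjoin_mem _ (glue h U) ('X_b - 'X_z) 1; rewrite mul1r hb.
  apply: sub_adjoin; have -> : h' i = h i by rewrite /h' /merge_into inE (negPf ib).
  by rewrite /glue /= raddfB /= !var_mapX !mnm_map1 hh subrr; exact: mideal0.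
rewrite -[f](subrK (var_map h' f)); apply: aD => //.
apply: (sub_mideal id1 _ gf) => m [_ [u Uu <-]] le.
rewrite -(submK le) mpolyXD; apply: aM.
rewrite -[X in adjoin _ _ X](subKr 'X_[u]) -var_mapX; apply: (is_idealB id1) => //.
apply: sub_adjoin; rewrite /glue /= var_mapX; apply/midealX.
by exists (mnm_map h u); [exists u|exact: lepm_refl].
Qed.

Lemma glue_subX_reg U (z b : 'I_n) (L : seq 'I_n) V1 V2 :
  z \notin L -> b \notin L -> b != z ->
  up (mnm_map (merge_into z L) @` U) = V1 `&` V2 ->
  up_closed V1 -> up_closed V2 ->
  (forall m, V1 (m + U_(b))%MM -> V1 m) ->
  (forall m, V2 (m + U_(z))%MM -> V2 m) ->
  forall f, glue (merge_into z L) U (('X_b - 'X_z) * f) ->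
            glue (merge_into z L) U f.
Proof.
move=> zL bL bz UV up1 up2 V1b V2z f; rewrite /glue /= UV rmorphM raddfB /=.
rewrite !var_mapX !mnm_map1 /merge_into (negPf zL) (negPf bL).
exact: mideal_subX_regI.
Qed.

(** The merged exponent set is an intersection of a set insensitive to [b] and a set insensitive to
    [z]: the form that makes [X_b - X_z] a nonzerodivisor. *)
Definition separates U z (L : seq 'I_n) b := exists V1 V2,
  [/\ up (mnm_map (merge_into z L) @` U) = V1 `&` V2,
      up_closed V1, up_closed V2,
      forall m, V1 (m + U_(b))%MM -> V1 m
    & forall m, V2 (m + U_(z))%MM -> V2 m].

Lemma uniq_merge (z b : 'I_n) bs L : uniq (z :: (b :: bs) ++ L) ->
  [/\ b != z, z \notin L, b \notin L & uniq (z :: bs ++ b :: L)].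
Proof.
have -> : uniq (z :: bs ++ b :: L) = uniq (z :: b :: bs ++ L).
  by apply: perm_uniq; rewrite perm_cons (perm_catCA bs [:: b] L).
move=> uq; rewrite uq; move: uq.
rewrite /= !inE !negb_or mem_cat negb_or => /and3P[/andP[zb /andP[_ zL]]].
by rewrite mem_cat negb_or => /andP[_ bL] _; rewrite eq_sym zb zL bL.
Qed.

(** Each step moves the head of [bs] into the list of merged variables, so these accumulate in
    reverse order, whence [catrev]. *)
Lemma regular_glue U z bs L s :
  uniq (z :: bs ++ L) ->
  (forall L' b, b \in bs -> b \notin L' -> {subset L' <= bs ++ L} ->
     separates U z L' b) ->
  regular_seq (glue (merge_into z (catrev bs L)) U) s ->
  regular_seq (glue (merge_into z L) U) ([seq 'X_b - 'X_z | b <- bs] ++ s).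
Proof.
elim: bs L => [//|b bs IH] L uq sep regs.
have [bz zL bL uq'] := uniq_merge uq.
apply/regular_seq_cons; first exact: is_ideal_glue.
have [V1 [V2 [UV up1 up2 V1b V2z]]] : separates U z L b.
  apply: sep => //; first exact: mem_head.
  by move=> i iL; rewrite inE mem_cat iL !orbT.
split; first exact: (glue_subX_reg zL bL bz UV).
rewrite adjoin_glue //; apply: IH => //.
move=> L' b' b'bs b'L' sL'; apply: sep => //; first by rewrite inE b'bs orbT.
by move=> i /sL'; rewrite !inE !mem_cat inE orbCA.
Qed.

Lemma ideal_gen_glue U z bs L : uniq (z :: bs ++ L) ->
  ideal_gen (glue (merge_into z L) U `|` [set` [seq 'X_b - 'X_z | b <- bs]]) =
  glue (merge_into z (catrev bs L)) U.
Proof.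
elim: bs L => [|b bs IH] L uq; first by rewrite ideal_gen_nil //; exact: is_ideal_glue.
have [bz zL bL uq'] := uniq_merge uq.
by rewrite [map _ _]/= ideal_gen_cons adjoin_glue //; exact: IH.
Qed.

End Gluing.

(** * Sumsets as exponents of powers *)

Section MSum.
Variables (n : nat) (S : set 'X_{1..n}).
Implicit Types (m u v : 'X_{1..n}).

Fixpoint msum t : set 'X_{1..n} :=
  if t is t'.+1 then msumset S (msum t') else [set 0%MM].

Lemma msum1 u : S u -> msum 1 u.
Proof. by move=> Su; exists u, 0%MM; rewrite addm0. Qed.

Lemma msum1P m : msum 1 m <-> S m.
Proof.
split=> [[u [v [Su -> ->]]]|]; last exact: msum1.
by rewrite addm0.
Qed.

Lemma msumD s t a b : msum s a -> msum t b -> msum (s + t) (a + b)%MM.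
Proof.
elim: s a => [|s IH] a /=; first by move=> ->; rewrite add0m.
move=> [u [v [Su Sv ->]]] Sb; exists u, (v + b)%MM; rewrite addmA.
by split=> //; exact: IH.
Qed.

Lemma msum_sum (T : Type) (r : seq T) (t : T -> nat) (F : T -> 'X_{1..n}) :
  (forall i, msum (t i) (F i)) ->
  msum (\sum_(i <- r) t i)%N (\sum_(i <- r) F i)%MM.
Proof.
move=> H; elim: r => [|i r IH]; first by rewrite !big_nil.
by rewrite !big_cons; exact: msumD.
Qed.

Lemma up_msum0 : up (msum 0) = setT.
Proof.
apply/seteqP; split=> // m _; exists 0%MM => //.
by apply/mnm_lepP => i; rewrite mnm0E.
Qed.

Lemma up_msumS t : msumset (up S) (up (msum t)) = up (msum t.+1).
Proof.
apply/seteqP; split=> m.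
  move=> [u' [v' [[u Su uu'] [v Sv vv'] ->]]]; exists (u + v)%MM; first by exists u, v.
  by apply/mnm_lepP => i; rewrite !mnmDE leq_add // ?(mnm_lepP uu') ?(mnm_lepP vv').
move=> [_ [u [v [Su Sv ->]]] le]; exists u, (v + (m - (u + v)))%MM; split.
- by exists u => //; exact: lepm_refl.
- by exists v => //; exact: lem_addr.
- by rewrite addmA addmC submK.
Qed.

End MSum.


(** * Depth, products of primes and powers of monomial ideals *)

Section Depth.
Variables (K : fieldType) (n : nat).
Implicit Types (J : set {mpoly K[n]}) (s : seq {mpoly K[n]}).

Lemma max_seq_comb s y : [set` s] `<=` @max_ideal K n -> y \in s ->
  exists c, y = \sum_b c b * 'X_b.
Proof. by move=> sm ys; exact: max_ideal_comb (sm y ys). Qed.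

Lemma depth_eq J s : [set` s] `<=` @max_ideal K n -> regular_seq J s ->
  (forall s', [set` s'] `<=` @max_ideal K n -> regular_seq J s' ->
     (size s' <= size s)%N) ->
  depth J = size s.
Proof.
move=> sm regs le; apply: xget_unique.
  by split; [exists s | move=> l [s' [<- s'm regs']]; exact: le].
move=> k [[s' [<- s'm regs']] maxs']; apply/eqP.
by rewrite eqn_leq le //=; apply: maxs'; exists s.
Qed.

(** The bound [N] ensures that a longest regular sequence exists, so that [depth] is a genuine
    maximum and not its default value. *)
Lemma depth_ge J s N : [set` s] `<=` @max_ideal K n -> regular_seq J s ->
  (forall s', [set` s'] `<=` @max_ideal K n -> regular_seq J s' ->
     (size s' <= N)%N) ->
  (size s <= depth J)%N.
Proof.
move=> sm regs le.
pose P k := `[< exists s', [/\ size s' = k, [set` s'] `<=` @max_ideal K n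
  & regular_seq J s'] >].
have Ps : P (size s) by apply/asboolP; exists s.
have PN k : P k -> (k <= N)%N by move=> /asboolP[s' [<- ? ?]]; exact: le.
have [k /asboolP[s' [sk s'm regs']] kmax] := ex_maxnP (ex_intro P _ Ps) PN.
rewrite (@depth_eq J s') ?sk //; first exact: kmax.
by move=> s'' s''m regs''; apply: kmax; apply/asboolP; exists s''.
Qed.

End Depth.

Lemma prime_monomial (K : fieldType) (n : nat) (P : set {mpoly K[n]}) m :
  is_prime_ideal P -> P 'X_[m] -> exists2 i, (0 < m i)%N & P 'X_i.
Proof.
move=> [_ P1 PM] Pm; apply: contrapT => nP; move: Pm; rewrite mpolyXE_id.
elim/big_ind: _ => [//|f g Pf Pg /PM[]//|i _].
have [->|mi] := posnP (m i); first by rewrite expr0.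
have Pi : ~ P 'X_i by move=> Pi; apply: nP; exists i.
elim: (m i) => [|k IH]; first by rewrite expr0.
by rewrite exprS => /PM[].
Qed.

Lemma ideal_prod_vars (K : fieldType) (n k : nat) (A : 'I_k -> set 'I_n) :
  ideal_prod (fun i => mideal (pvars (A i))) =
  mideal [set m | exists2 a : 'I_k -> 'I_n, forall i, A i (a i) &
    ((\sum_i U_(a i))%MM <= m)%MM] :> set {mpoly K[n]}.
Proof.
rewrite /ideal_prod; elim: k A => [|k IH] A.
  rewrite big_ord0 -[LHS]setT_mideal; congr mideal; apply/seteqP; split=> // m _.
  have a0 : 'I_0 -> 'I_n by case.
  exists a0; first by case.
  by rewrite big_ord0; apply/mnm_lepP => i; rewrite mnm0E.
rewrite big_ord_recl (IH (fun i => A (lift ord0 i))) ideal_mul_mideal; last first.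
  by move=> m m' [a Aa am] mm'; exists a => //; exact: lepm_trans mm'.
congr mideal; apply/seteqP; split=> m.
  move=> [u [v [[i0 Ai0 ui0] [a Aa av] ->]]].
  exists (fun i => if unlift ord0 i is Some j then a j else i0) => [i|].
    by case: unliftP => [j ->|->]; [exact: Aa|].
  rewrite big_ord_recl unlift_none; apply/mnm_lepP => j; rewrite !mnmDE.
  apply: leq_add; first by rewrite mnm1E; case: eqP => [<-|].
  rewrite (eq_bigr (fun i => U_(a i)%MM)); first exact: (mnm_lepP av).
  by move=> i _; rewrite liftK.
move=> [a Aa]; rewrite big_ord_recl => le.
exists U_(a ord0)%MM, (m - U_(a ord0))%MM; split.
- by exists (a ord0) => //; rewrite mnm1E eqxx.
- exists (fun i => a (lift ord0 i)) => //; apply/mnm_lepP => j.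
  have /mnm_lepP/(_ j) := le; rewrite mnmBE mnmDE /=.
  by move: ((\sum_(i < k) _)%MM j) => c; lia.
- rewrite addmC submK //; apply: lepm_trans le; exact: lem_addr.
Qed.

Lemma ideal_exp_mideal (K : fieldType) (n : nat) (S : set 'X_{1..n})
  (I : set {mpoly K[n]}) t :
  I = mideal (up S) -> ideal_exp I t = mideal (up (msum S t)).
Proof.
move=> ->; elim: t => [|t IH]; first by rewrite up_msum0 setT_mideal.
rewrite -up_msumS -ideal_mul_mideal; last exact: up_closed_up.
by rewrite -IH.
Qed.

(** * Exchange components of a polymatroid *)

Section Polymatroid.
Variables (n d : nat) (S : set 'X_{1..n}).
Implicit Types (m u v w : 'X_{1..n}) (C : pred 'I_n).

Hypothesis Sdeg : forall m, S m -> mdeg m = d.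
Hypothesis Sexch : forall u v, S u -> S v -> forall i, (v i < u i)%N ->
  exists j w, [/\ (u j < v j)%N, S w & (w + U_(i) = u + U_(j))%MM].

(** Stated additively because subtraction of exponents is truncated: [v] is [u] with [i] exchanged
    for [j]. *)
Definition exch_rel (i j : 'I_n) :=
  `[< exists u v, [/\ S u, S v & (u + U_(j) = v + U_(i))%MM] >].

Lemma exch_rel_sym : ssrbool.symmetric exch_rel.
Proof.
by move=> i j; apply/asboolP/asboolP => -[u [v [Su Sv E]]]; exists v, u.
Qed.

Lemma exch_connect_sym : connect_sym exch_rel.
Proof. exact/sym_connect_sym/exch_rel_sym. Qed.

Definition component i := fingraph.root exch_rel i.

Lemma comp_rel i j : exch_rel i j -> component i = component j.
Proof.
by move=> ij; apply/eqP; rewrite (root_connect exch_connect_sym) connect1.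
Qed.

Lemma comp_root i : component (component i) = component i.
Proof. exact: (root_root exch_connect_sym). Qed.

(** The exchange itself is an edge of the graph, so it stays on one side of any union [C] of
    components. *)
Lemma Sexch_in C u v : (forall i j, exch_rel i j -> C i = C j) ->
  S u -> S v -> forall i, (v i < u i)%N ->
  exists j w, [/\ S w, (u j < v j)%N, C i = C j &
   [/\ forall k, k != i -> k != j -> w k = u k, (w i).+1 = u i,
       w j = (u j).+1 & (w + U_(i) = u + U_(j))%MM]].
Proof.
move=> CC Su Sv i vu; have [j [w [uv Sw E]]] := Sexch Su Sv vu.
have ij : i != j by apply: contraTneq vu => ->; rewrite -leqNgt ltnW.
exists j, w; split=> //; first by apply/CC/asboolP; exists u, w.
have Ek k : (w k + (i == k) = u k + (j == k))%N.
  by have /mnmP/(_ k) := E; rewrite !mnmDE !mnm1E.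
split=> // [k ki kj||].
- by have := Ek k; rewrite eq_sym (negPf ki) eq_sym (negPf kj) !addn0.
- by have := Ek i; rewrite eqxx [j == i]eq_sym (negPf ij) addn1 addn0.
- by have := Ek j; rewrite eqxx (negPf ij) addn1 addn0.
Qed.

Definition cdeg C m := (\sum_(i | C i) m i)%N.

Lemma cdegD C m1 m2 : cdeg C (m1 + m2) = (cdeg C m1 + cdeg C m2)%N.
Proof. by rewrite /cdeg -big_split; apply: eq_bigr => i _; rewrite mnmDE. Qed.

Lemma cdeg1 C i : cdeg C U_(i) = C i.
Proof.
rewrite /cdeg; case: (boolP (C i)) => Ci.
  rewrite (bigD1 i) //= mnm1E eqxx big1 // => j /andP[_ ji].
  by rewrite mnm1E eq_sym (negPf ji).
rewrite big1 // => j Cj; rewrite mnm1E; case: eqP => // ij.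
by rewrite -ij (negPf Ci) in Cj.
Qed.

Lemma cdeg_le C m1 m2 : (m1 <= m2)%MM -> (cdeg C m1 <= cdeg C m2)%N.
Proof. by move=> /mnm_lepP le; apply: leq_sum. Qed.

Lemma le_sum_eq C m1 m2 : (forall i, C i -> (m1 i <= m2 i)%N) ->
  (cdeg C m2 <= cdeg C m1)%N -> forall i, C i -> m1 i = m2 i.
Proof.
move=> le12 le21 i Ci; apply/eqP; rewrite eqn_leq le12 //=.
move: le21; rewrite /cdeg !(bigD1 i Ci) /=.
have : (\sum_(j | C j && (j != i)) m1 j <= \sum_(j | C j && (j != i)) m2 j)%N.
  by apply: leq_sum => j /andP[/le12].
by move: (\sum_(j | _) m1 j)%N (\sum_(j | _) m2 j)%N => a b; lia.
Qed.

Lemma not_le_exists C m1 m2 : ~ (forall i, C i -> (m1 i <= m2 i)%N) ->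
  exists2 i, C i & (m2 i < m1 i)%N.
Proof.
move=> nle; apply: contrapT => nex; apply: nle => i Ci.
by rewrite leqNgt; apply/negP => lt; apply: nex; exists i.
Qed.

(* Truncated subtraction: only the entries where [u] exceeds [v] count. *)
Definition excess C u v := (\sum_(i | C i) (u i - v i))%N.

Lemma excess_exch C u v w i j : C i -> (v i < u i)%N -> (u j < v j)%N ->
  (forall k, k != i -> k != j -> w k = u k) -> (w i).+1 = u i ->
  w j = (u j).+1 -> (excess C w v < excess C u v)%N.
Proof.
move=> Ci vu uv wk wi wj; rewrite /excess !(bigD1 i Ci) /=.
have : (\sum_(k | C k && (k != i)) (w k - v k) <=
        \sum_(k | C k && (k != i)) (u k - v k))%N.
  apply: leq_sum => k /andP[_ ki]; case: (eqVneq k j) => [->|kj].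
    by rewrite wj; lia.
  by rewrite wk.
move: (\sum_(k | _) (w k - v k))%N (\sum_(k | _) (u k - v k))%N => a b.
by move: wi vu; lia.
Qed.

(** Exchanging [u] towards [v] lowers [excess] and keeps the degree on [C], since both variables of
    each exchange lie on the same side of [C]. *)
Lemma cdeg_const C u v : (forall i j, exch_rel i j -> C i = C j) ->
  S u -> S v -> cdeg C u = cdeg C v.
Proof.
move=> CC; have [N] := ubnP (excess predT u v).
elim: N u => // N IH u /ltnSE le Su Sv.
case: (pselect (forall i, predT i -> (u i <= v i)%N)) => [uv|].
  suff -> : u = v by [].
  apply/mnmP => i; apply: (le_sum_eq uv) => //.
  by have := Sdeg Su; rewrite -(Sdeg Sv) !mdegE /cdeg => ->.
move/not_le_exists => [i _ vu].
have [j [w [Sw uv Cij [wk wi wj E]]]] := Sexch_in CC Su Sv vu.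
rewrite -(IH w) //; last first.
  by apply: leq_trans le; exact: (excess_exch _ vu uv wk wi wj).
have : cdeg C (w + U_(i)) = cdeg C (u + U_(j)) by rewrite E.
by rewrite !cdegD !cdeg1 Cij => /addIn.
Qed.

(** Only exchanges outside [C] are made, so [u] is kept on [C]; once [u] no longer exceeds [v]
    outside [C], equal degrees force equality there. *)
Lemma Smix C u v : (forall i j, exch_rel i j -> C i = C j) -> S u -> S v ->
  exists w, [/\ S w, forall i, C i -> w i = u i & forall i, ~~ C i -> w i = v i].
Proof.
move=> CC; have [N] := ubnP (excess (predC C) u v).
elim: N u => // N IH u /ltnSE le Su Sv.
have CC' i j : exch_rel i j -> predC C i = predC C j by move/CC => /= ->.
case: (pselect (forall i, predC C i -> (u i <= v i)%N)) => [uv|].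
  exists u; split=> // i Ci; apply: (le_sum_eq uv) => //.
  by rewrite (cdeg_const CC' Su Sv).
move/not_le_exists => [i Ci vu].
have [j [w [Sw uv Cij [wk wi wj E]]]] := Sexch_in CC' Su Sv vu.
have [|w' [Sw' w'1 w'2]] := IH w _ Sw Sv.
  by apply: leq_trans le; exact: (excess_exch _ vu uv wk wi wj).
exists w'; split=> // k Ck; rewrite w'1 // wk //.
  by apply: contraTneq Ck => ->.
by apply: contraTneq Ck => ->; move: Ci; rewrite Cij.
Qed.

Lemma cdeg_msum C t u m : (forall i j, exch_rel i j -> C i = C j) ->
  S u -> msum S t m -> cdeg C m = (t * cdeg C u)%N.
Proof.
move=> CC Su; elim: t m => [|t IH] m /=.
  by move=> ->; rewrite mul0n /cdeg big1 // => i _; rewrite mnm0E.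
move=> [a [b [Sa Sb ->]]].
by rewrite cdegD (IH b Sb) (cdeg_const CC Sa Su) mulSn.
Qed.

Lemma mdeg_msum t m : msum S t m -> mdeg m = (t * d)%N.
Proof.
elim: t m => [|t IH] m /=; first by move=> ->; rewrite mdeg0.
by move=> [a [b [Sa /IH Sb ->]]]; rewrite mdegD Sb (Sdeg Sa) mulSn.
Qed.

Lemma msum_mix C t u v : (forall i j, exch_rel i j -> C i = C j) ->
  msum S t u -> msum S t v ->
  exists w, [/\ msum S t w, forall i, C i -> w i = u i & forall i, ~~ C i -> w i = v i].
Proof.
move=> CC; elim: t u v => [|t IH] u v /=.
  by move=> -> ->; exists 0%MM.
move=> [u1 [u2 [Su1 Su2 ->]]] [v1 [v2 [Sv1 Sv2 ->]]].
have [w1 [Sw1 w1u w1v]] := Smix CC Su1 Sv1.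
have [w2 [Sw2 w2u w2v]] := IH _ _ Su2 Sv2.
exists (w1 + w2)%MM; split; first by exists w1, w2.
  by move=> i Ci; rewrite !mnmDE w1u ?w2u.
by move=> i Ci; rewrite !mnmDE w1v ?w2v.
Qed.

Definition in_comp r : pred 'I_n := fun i => component i == r.

Lemma in_comp_rel r i j : exch_rel i j -> in_comp r i = in_comp r j.
Proof. by move=> /comp_rel ij; rewrite /in_comp ij. Qed.

(** Let [C] be the component of [b], which the merging does not touch. By recombination, membership
    splits into a condition off [C], which ignores [b], and a condition on [C], which ignores
    [z]. *)
Lemma separates_msum t z L b : component z != component b ->
  (forall i, i \in L -> component i != component b) ->
  separates (up (msum S t)) z L b.
Proof.
move=> zb Lb; set h := merge_into z L; pose C := in_comp (component b).
have hC i : C i -> h i = i.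
  rewrite /h /merge_into; case: ifP => // /Lb ib; rewrite /C /in_comp.
  by rewrite (negPf ib).
have hC' i : C (h i) = C i.
  rewrite /h /merge_into; case: ifP => // /Lb ib.
  by rewrite /C /in_comp (negPf zb) (negPf ib).
have mapC m j : C j -> mnm_map h m j = m j.
  move=> Cj; rewrite mnm_mapE (big_pred1 j) // => i /=.
  apply/eqP/eqP => [hi|->]; last exact: hC.
  by rewrite -hi hC // -hC' hi.
exists [set m | exists2 m', msum S t m' &
          forall j, ~~ C j -> (mnm_map h m' j <= m j)%N].
exists [set m | exists2 m', msum S t m' & forall j, C j -> (m' j <= m j)%N].
split.
- apply/seteqP; split=> m.
    move=> [_ [u [m' Sm' m'u] <-] um].
    have le : (mnm_map h m' <= m)%MM by apply: lepm_trans um; exact: mnm_map_le.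
    split; exists m' => // j Cj; first exact: (mnm_lepP le).
    by rewrite -(mapC m' j Cj); exact: (mnm_lepP le).
  move=> [[m1 Sm1 le1] [m2 Sm2 le2]].
  have [w [Sw wm2 wm1]] := msum_mix (@in_comp_rel (component b)) Sm2 Sm1.
  exists (mnm_map h w).
    by exists w => //; exists w => //; exact: lepm_refl.
  apply/mnm_lepP => j; case: (boolP (C j)) => Cj.
    by rewrite mapC // wm2 // le2.
  apply: leq_trans (le1 j Cj); rewrite !mnm_mapE; apply/eq_leq/eq_bigr => i /eqP hi.
  by apply: wm1; move: Cj; rewrite -hi hC'.
- move=> m m' [a Sa am] mm'; exists a => // j /am le.
  by apply: leq_trans le _; exact: (mnm_lepP mm').
- move=> m m' [a Sa am] mm'; exists a => // j /am le.
  by apply: leq_trans le _; exact: (mnm_lepP mm').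
- move=> m [a Sa am]; exists a => // j Cj; have := am j Cj.
  rewrite mnmDE mnm1E; case: eqP Cj => [<-|]; last by rewrite addn0.
  by rewrite /C /in_comp eqxx.
- move=> m [a Sa am]; exists a => // j Cj; have := am j Cj.
  rewrite mnmDE mnm1E; case: eqP Cj => [<-|]; last by rewrite addn0.
  by rewrite /C /in_comp (negPf zb).
Qed.

(* The exponent [g - U_(r)], with [r] the root of a component, is one step
   below the [t]-fold sums of bases in all directions of that component. *)
Definition pivot t g :=
  [/\ msum S t g, forall y, (0 < g (component y))%N
    & forall y, exists2 m, up (msum S t) m & (m + U_(component y) = g + U_(y))%MM].

Hypothesis Sfull : forall i, exists2 m, S m & (0 < m i)%N.
Hypothesis Sn0 : exists m, S m.

(** One pair of bases is taken for each edge of the path; in the sum the exchanges telescope. *)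
Lemma connect_msum x y : connect exch_rel x y ->
  exists t a b, [/\ msum S t a, msum S t b & (b + U_(x) = a + U_(y))%MM].
Proof.
move/connectP => [p]; elim: p x => [|x' p IH] x /=.
  by move=> _ ->; exists 0%N, 0%MM, 0%MM.
move=> /andP[/asboolP[u [v [Su Sv E]]] xp yE].
have [t [a [b [Sa Sb E']]]] := IH _ xp yE.
exists t.+1, (u + a)%MM, (v + b)%MM; split; first by exists u, a.
  by exists v, b.
apply/mnmP => k; have /mnmP/(_ k) := E; have /mnmP/(_ k) := E'.
by rewrite !mnmDE; lia.
Qed.

Lemma exists_pivot : exists t g, (0 < t)%N /\ pivot t g.
Proof.
have H y : exists tab : nat * 'X_{1..n} * 'X_{1..n},
    [/\ msum S tab.1.1 tab.1.2, msum S tab.1.1 tab.2 &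
        (tab.2 + U_(component y) = tab.1.2 + U_(y))%MM].
  have cy : connect exch_rel (component y) y.
    by rewrite exch_connect_sym connect_root.
  have [t [a [b [Sa Sb E]]]] := connect_msum cy.
  by exists (t, a, b).
have {H}[F HF] := choice H.
have H y : exists m, S m /\ (0 < m y)%N by have [m] := Sfull y; exists m.
have {H}[B HB] := choice H; have [u0 Su0] := Sn0.
pose T y := ((F y).1.1 + 1)%N; pose A y := ((F y).1.2 + B y)%MM.
have SA y : msum S (T y) (A y).
  have [Sa _ _] := HF y; apply: msumD => //.
  by have [SB _] := HB y; exact: msum1.
(* The summand [u0] keeps the number of bases positive even without variables, the paths in [F]
   provide the exchanges, and [B] makes every root divide the product. *)
exists (1 + \sum_(y <- enum 'I_n) T y)%N, (u0 + \sum_(y <- enum 'I_n) A y)%MM.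
split=> //; split.
- by apply: msumD; [exact: msum1|exact: msum_sum].
- move=> y; rewrite mnmDE mnm_sumE big_enum /= (bigD1 (component y)) //=.
  by rewrite mnmDE; have [_] := HB (component y); lia.
(* Replacing the summand of [y] by the other end of its path trades the root for [y]. *)
- move=> y; pose A' x := (if x == y then (F y).2 + B y else A x)%MM.
  have [_ Sb E] := HF y.
  exists (u0 + \sum_(x <- enum 'I_n) A' x)%MM.
    exists (u0 + \sum_(x <- enum 'I_n) A' x)%MM; last exact: lepm_refl.
    apply: msumD; first exact: msum1.
    apply: msum_sum => x; rewrite /A'; case: (eqVneq x y) => [->|_] //.
    by apply: msumD => //; have [SB _] := HB y; exact: msum1.
  apply/mnmP => k; rewrite !mnmDE !mnm_sumE !big_enum /= !(bigD1 y (erefl _)) /=.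
  rewrite [in LHS](eq_bigr (fun x => A x k)); last first.
    by move=> x /negPf xy; rewrite /A' xy.
  rewrite /A' eqxx /A !mnmDE; have /mnmP/(_ k) := E; rewrite !mnmDE.
  by move: (\sum_(i | _) _)%N => s; lia.
Qed.

(** * Ranks of the components *)

Definition roots_seq := [seq r <- enum 'I_n | component r == r].

Lemma mem_roots r : (r \in roots_seq) = (component r == r).
Proof. by rewrite mem_filter mem_enum andbT. Qed.

Lemma roots_uniq : uniq roots_seq.
Proof. exact/filter_uniq/enum_uniq. Qed.

Lemma comp_in_roots i : component i \in roots_seq.
Proof. by rewrite mem_roots comp_root. Qed.

Lemma sum_cdeg u : (\sum_(r <- roots_seq) cdeg (in_comp r) u)%N = mdeg u.
Proof.
rewrite mdegE /cdeg /roots_seq big_filter big_enum_cond /=.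
rewrite (exchange_big_dep predT) //=; apply: eq_bigr => i _.
rewrite (big_pred1 (component i)) // => r /=; rewrite /in_comp.
case: (eqVneq r (component i)) => [->|ri]; first by rewrite comp_root !eqxx.
by rewrite andbF.
Qed.

Lemma cdeg_gt0 r u : S u -> component r = r -> (0 < cdeg (in_comp r) u)%N.
Proof.
move=> Su cr; have [v Sv vr] := Sfull r.
rewrite (cdeg_const (@in_comp_rel r) Su Sv) /cdeg (bigD1 r) ?/in_comp ?cr //=.
by move: vr; lia.
Qed.

Lemma size_roots_le : (size roots_seq <= d)%N.
Proof.
have [u Su] := Sn0; rewrite -(Sdeg Su) -sum_cdeg -sum1_size.
rewrite big_seq [X in (_ <= X)%N]big_seq; apply: leq_sum => r.
by rewrite mem_roots => /eqP; exact: cdeg_gt0.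
Qed.

Lemma size_roots_eq u r : size roots_seq = d -> S u -> component r = r ->
  cdeg (in_comp r) u = 1%N.
Proof.
move=> sd Su cr; apply/eqP; rewrite eq_sym eqn_leq cdeg_gt0 //=.
move: sd; rewrite -(Sdeg Su) -sum_cdeg -sum1_size.
have rr : r \in roots_seq by rewrite mem_roots cr.
rewrite !(bigD1_seq r rr roots_uniq) /=.
have : (\sum_(i <- roots_seq | i != r) 1 <=
        \sum_(i <- roots_seq | i != r) cdeg (in_comp i) u)%N.
  rewrite big_seq_cond [X in (_ <= X)%N]big_seq_cond; apply: leq_sum => i.
  by rewrite mem_roots => /andP[/eqP ci _]; exact: cdeg_gt0.
by move: (\sum_(i <- _ | _) 1)%N (\sum_(i <- _ | _) cdeg _ _)%N => a b; lia.
Qed.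

Lemma size_roots_lt u : (size roots_seq < d)%N -> S u ->
  exists2 r, component r = r & (1 < cdeg (in_comp r) u)%N.
Proof.
move=> sd Su; apply: contrapT => nr; move: sd; apply/negP; rewrite -leqNgt.
rewrite -(Sdeg Su) -sum_cdeg -sum1_size.
rewrite big_seq [X in (_ <= X)%N]big_seq; apply: leq_sum => r.
rewrite mem_roots => /eqP cr; rewrite leqNgt; apply/negP => lt.
by apply: nr; exists r.
Qed.

(** Starting from any basis, its part on one component after another is replaced by that of a basis
    containing the prescribed variable. *)
Lemma exists_transversal (a : 'I_n -> 'I_n) :
  (forall r, component r = r -> component (a r) = r) ->
  exists2 w, S w & forall r, component r = r -> (0 < w (a r))%N.
Proof.
move=> ca; suff [w [Sw wa]] : exists w, S w /\
    forall r, r \in roots_seq -> (0 < w (a r))%N.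
  by exists w => // r cr; apply: wa; rewrite mem_roots cr.
have : {subset roots_seq <= roots_seq} by [].
elim: {1 3}roots_seq => [|r rs IH] sub.
  by have [w Sw] := Sn0; exists w.
have [|w [Sw wa]] := IH; first by move=> i irs; apply: sub; rewrite inE irs orbT.
have cr : component r = r by apply/eqP; rewrite -mem_roots; apply: sub; exact: mem_head.
have [v Sv va] := Sfull (a r).
have [w' [Sw' w'v w'w]] := Smix (@in_comp_rel r) Sv Sw.
exists w'; split=> // i; rewrite inE => /orP[/eqP->|irs].
  by rewrite w'v // /in_comp ca.
case: (eqVneq i r) => [->|ir]; first by rewrite w'v // /in_comp ca.
rewrite w'w ?wa // /in_comp ca //.
by apply/eqP; rewrite -mem_roots; apply: sub; rewrite inE irs orbT.
Qed.

(** * The case where all components have rank one *)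

Section Transversal.
Hypothesis Stransversal : size roots_seq = d.

(** All ranks are 1. If [m] has degree at least [t + 1] on each component, one variable of [m] from
    each gives a basis dividing [m]; removing it lowers all component degrees by 1. *)
Lemma up_msum_transversal t m : up (msum S t) m <->
  forall r, component r = r -> (t <= cdeg (in_comp r) m)%N.
Proof.
have [u Su] := Sn0; split.
  move=> [m' Sm' le] r cr; apply: leq_trans (cdeg_le _ le).
  rewrite (cdeg_msum (@in_comp_rel r) Su Sm').
  by rewrite (size_roots_eq Stransversal Su cr) muln1.
elim: t m => [|t IH] m tm; first by rewrite up_msum0.
have H r : exists i, component r = r -> component i = r /\ (0 < m i)%N.
  case: (pselect (component r = r)) => [cr|]; last by exists r.
  have := tm _ cr; apply: contraPP => ni; apply/negP; rewrite -leqNgt.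
  rewrite /cdeg big1 // => i /eqP ir; apply/eqP; rewrite -leqn0 leqNgt.
  by apply/negP => mi; apply: ni; exists i.
have {H}[a Ha] := choice H.
have [|w Sw wa] := @exists_transversal a.
  by move=> r /[dup] cr /Ha[].
have w1 r := size_roots_eq Stransversal Sw (r := r).
(* On each component [w] is supported at the chosen variable alone, with exponent 1. *)
have wm : (w <= m)%MM.
  apply/mnm_lepP => i; have cr := comp_root i.
  have [ca ma] := Ha _ cr; have wr := wa _ cr; have := w1 _ cr.
  rewrite /cdeg (bigD1 (a (component i))) /=; last by rewrite /in_comp ca.
  move=> E; case: (eqVneq i (a (component i))) => [iE|ia].
    have : (w (a (component i)) <= m (a (component i)))%N by move: E ma; lia.
    by rewrite -iE.
  move: E; rewrite (bigD1 i) /=; last by rewrite /in_comp eqxx.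
  by move: wr; lia.
rewrite -up_msumS; exists w, (m - w)%MM; split.
- by exists w => //; exact: lepm_refl.
- apply: IH => r cr; have := tm _ cr; rewrite -{1}(submK wm) cdegD w1 //.
  by rewrite addn1.
- by rewrite addmC submK.
Qed.

(** The pivot is [t] times the basis formed by the roots; trading a root for another variable of its
    component keeps all component degrees. *)
Lemma transversal_pivot t : (0 < t)%N -> exists g, pivot t g.
Proof.
move=> t0; have [//|w Sw wr] := @exists_transversal id.
have Sg : msum S t (\sum_(i < t) w)%MM.
  have := @msum_sum n S _ (index_enum 'I_t) (fun=> 1%N) (fun=> w).
  rewrite sum1_card card_ord; apply => _; exact: msum1.
exists (\sum_(i < t) w)%MM; split=> // y.
  rewrite mnm_sumE sum_nat_const card_ord muln_gt0 t0 /=.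
  by apply: wr; exact: comp_root.
have gy : (U_(component y) <= (\sum_(i < t) w) + U_(y))%MM.
  rewrite lep1mP -lt0n mnmDE ltn_addr // mnm_sumE sum_nat_const card_ord.
  by rewrite muln_gt0 t0 wr // comp_root.
exists ((\sum_(i < t) w) + U_(y) - U_(component y))%MM; last by rewrite submK.
apply/up_msum_transversal => r cr.
have : cdeg (in_comp r) (\sum_(i < t) w + U_(y) - U_(component y) + U_(component y)) =
       cdeg (in_comp r) (\sum_(i < t) w + U_(y)) by rewrite submK.
rewrite !cdegD !cdeg1 /in_comp comp_root => /addIn ->.
by rewrite (cdeg_msum (@in_comp_rel r) Sw Sg) (size_roots_eq Stransversal Sw cr) muln1.
Qed.

End Transversal.


(** * Associated primes and depth of powers *)

Section MonomialPowers.
Variable K : fieldType.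
Implicit Types (f q : {mpoly K[n]}).

Let powI t : set {mpoly K[n]} := mideal (up (msum S t)).

Definition comp_prime r : set {mpoly K[n]} :=
  mideal (pvars [set i | component i = r]).

Lemma is_ideal_powI t : is_ideal (powI t).
Proof. exact/is_ideal_mideal/up_closed_up. Qed.

(** Multiplying [g / x_r] by a variable of the component lands in the power, as [g] is a pivot. A
    monomial avoiding the component leaves its degree there one below the constant value on
    [msum S t]. *)
Lemma pivot_Ass t g r : pivot t g -> component r = r ->
  Ass (powI t) (comp_prime r).
Proof.
move=> [Sg gpos gy] cr; split; first exact: mideal_pvars_prime.
have gr : (0 < g r)%N by rewrite -cr.
exists 'X_[g - U_(r)]; apply/seteqP; split=> q /=.
  move=> Pq; apply/midealMX => m /Pq[y cy my] /=.
  have [m' Um' E] := gy y; apply: (up_closed_up Um').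
  apply/mnm_lepP => k; have /mnmP/(_ k) := E.
  rewrite cy !mnmDE mnmBE !mnm1E.
  have : ((y == k) <= m k)%N by case: eqP => [<-|].
  have : ((r == k) <= g k)%N by case: eqP => [<-|].
  by lia.
move=> /midealMX H m /H /= [s Ss le]; apply: contrapT => nm.
have [u Su] := Sn0; have := cdeg_le (in_comp r) le.
rewrite cdegD (cdeg_msum (@in_comp_rel r) Su Ss).
rewrite -(cdeg_msum (@in_comp_rel r) Su Sg).
rewrite -{1}(submK (m := U_(r)) (m' := g)) ?lep1mP -?lt0n // cdegD cdeg1.
rewrite /in_comp cr eqxx -/(in_comp r) [cdeg (in_comp r) m]big1; first by lia.
move=> i /eqP ci; apply/eqP; rewrite -leqn0 leqNgt; apply/negP => mi.
by apply: nm; exists i.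
Qed.

Lemma d_gt0 (z : 'I_n) : (0 < d)%N.
Proof.
have [m Sm mz] := Sfull z; rewrite -(Sdeg Sm) mdegE (bigD1 z) //=.
by rewrite addn_gt0 mz.
Qed.

Lemma up_msum_neq0 t (z : 'I_n) : (0 < t)%N -> ~ up (msum S t) 0%MM.
Proof.
move=> t0 [s Ss le]; have := mdeg_msum Ss; have -> : s = 0%MM.
  apply/mnmP => i; apply/eqP; rewrite mnm0E -leqn0.
  by have /mnm_lepP/(_ i) := le; rewrite mnm0E.
by move/eqP; rewrite mdeg0 eq_sym muln_eq0 !eqn0Ngt t0 (d_gt0 z).
Qed.

Lemma roots_split : (0 < n)%N -> exists z bs, roots_seq = z :: bs.
Proof.
move=> n0; case E : roots_seq => [|z bs]; last by exists z, bs.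
by have := comp_in_roots (Ordinal n0); rewrite E.
Qed.

Lemma merge_roots z bs i : roots_seq = z :: bs -> component i = i ->
  merge_into z (catrev bs [::]) i = z.
Proof.
move=> E ci; rewrite /merge_into catrevE cats0 mem_rev; case: ifPn => // ibs.
have : i \in roots_seq by rewrite mem_roots ci.
by rewrite E inE (negPf ibs) orbF => /eqP.
Qed.

Lemma merge_nonroot z bs i : roots_seq = z :: bs -> component i != i ->
  merge_into z (catrev bs [::]) i = i.
Proof.
move=> E ci; rewrite /merge_into catrevE cats0 mem_rev; case: ifPn => // ibs.
have : i \in roots_seq by rewrite E inE ibs orbT.
by rewrite mem_roots (negPf ci).
Qed.

Lemma regular_roots t z bs s : roots_seq = z :: bs ->
  regular_seq (glue (merge_into z (catrev bs [::])) (up (msum S t))) s ->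
  regular_seq (powI t) ([seq 'X_b - 'X_z | b <- bs] ++ s).
Proof.
move=> E regs.
have := roots_uniq; rewrite E => uq.
have cE i : i \in z :: bs -> component i = i.
  by rewrite -E mem_roots => /eqP.
(* Merging along the empty list changes nothing, which presents the power as a [glue]. *)
rewrite /powI -(glue_id K (h := merge_into z [::])) //; last exact: up_closed_up.
apply: regular_glue => //; first by rewrite cats0.
move=> L' b bbs bL' sL'; apply: separates_msum.
  rewrite !cE ?mem_head ?inE ?bbs ?orbT //.
  by apply: contraTneq uq => ->; rewrite /= bbs.
move=> i iL'; have := sL' _ iL'; rewrite cats0 => ibs.
rewrite !cE ?inE ?bbs ?ibs ?orbT //.
by apply: contraNneq bL' => <-.
Qed.

Lemma subX_max (z : 'I_n) (bs : seq 'I_n) (y : {mpoly K[n]}) :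
  y \in [seq 'X_b - 'X_z | b <- bs] -> @max_ideal K n y.
Proof.
move=> /mapP[b _ ->]; apply: (is_idealB (is_ideal_gen _)).
  by apply: sub_gen_smallest; exists b.
by apply: sub_gen_smallest; exists z.
Qed.

Lemma pivot_depth t g : (0 < n)%N -> (0 < t)%N -> pivot t g ->
  depth (powI t) = (size roots_seq).-1.
Proof.
move=> n0 t0 [Sg gpos gy]; have [z [bs E]] := roots_split n0.
have cz : component z = z by apply/eqP; rewrite -mem_roots E mem_head.
have := roots_uniq; rewrite E => uq.
pose h := merge_into z (catrev bs [::]).
pose s : seq {mpoly K[n]} := [seq 'X_b - 'X_z | b <- bs].
have -> : (size (z :: bs)).-1 = size s by rewrite size_map.
have regs : regular_seq (powI t) s.
  rewrite -[s]cats0; apply: regular_roots => //.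
  apply/regular_seq_nil; first exact: is_ideal_glue.
  move=> gT; apply: (glue_prop (K := K) (h := h) (up_msum_neq0 z t0)).
  by rewrite gT.
apply: depth_eq => //.
  by move=> y; exact: subX_max.
move=> s' s'm regs'.
have gE : ideal_gen (powI t `|` [set` s]) = glue h (up (msum S t)).
  rewrite /powI -(glue_id K (h := merge_into z [::])) //; last exact: up_closed_up.
  by rewrite ideal_gen_glue // cats0.
have gz : (U_(z) <= g)%MM by rewrite lep1mP -lt0n -{1}cz.
apply: (regular_size_le (x := fun i => 'X_i) (u := 'X_[g - U_(z)])
  (is_ideal_powI t) regs _ _ regs').
(* Merging preserves total degree, and [g / x_z] has degree one less than the generators. *)
- rewrite gE /glue /= var_mapX => /midealX[_ [u [m Sm mu] <-] le].
  have : (mdeg m <= mdeg (g - U_(z)))%N.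
    rewrite -(mdeg_mnm_map h (g - _)) -(mdeg_mnm_map h m) !mdegE.
    apply: leq_sum => i _; apply: (mnm_lepP _ i); apply: lepm_trans le.
    exact: mnm_map_le.
  have : mdeg (g - U_(z) + U_(z)) = mdeg g by rewrite submK.
  by rewrite mdegD mdeg1 (mdeg_msum Sm) (mdeg_msum Sg); lia.
(* All roots are merged into [z], so dividing by [x_z] amounts to dividing by the root of [y]. *)
- move=> y; rewrite gE /glue /= -mpolyXD var_mapX; apply/midealX.
  have [m Um Em] := gy y; exists (mnm_map h m); first by exists m.
  suff -> : mnm_map h (U_(y) + (g - U_(z))) = mnm_map h m by exact: lepm_refl.
  apply: (@addIm _ U_(z)%MM); rewrite /=.
  have hz : U_(z)%MM = mnm_map h U_(z) by rewrite mnm_map1 /h merge_roots.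
  have hy : U_(z)%MM = mnm_map h U_(component y).
    by rewrite mnm_map1 /h merge_roots // comp_root.
  rewrite {2}hz {3}hy -!mnm_mapD Em -addmA submK // addmC //.
- by move=> y; exact: max_seq_comb.
Qed.

(** * Squarefree ideals with a component of rank at least two *)

Section SquareFree.
Hypothesis Ssqf : forall m i, S m -> (m i <= 1)%N.

(** Suppose the prime is [(I : f)] and let [m] be a monomial of [f] outside [I]. As bases are
    squarefree, no variable of the component divides [m], so a basis dividing [x_r m] has degree at
    most 1 on the component, against rank at least 2. *)
Lemma not_Ass_squarefree u r : S u -> component r = r ->
  (1 < cdeg (in_comp r) u)%N -> ~ Ass (powI 1) (comp_prime r).
Proof.
move=> Su cr ur [[_ P1 _] [f PE]].
have fJ : ~ powI 1 f.
  by move=> Jf; apply: P1; rewrite PE /= mul1r.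
have {fJ}[m mf Um] : exists2 m, m \in msupp f & ~ up (msum S 1) m.
  apply: contrapT => nm; apply: fJ => m mf; apply: contrapT => Um.
  by apply: nm; exists m.
have H y : component y = r ->
    exists B, [/\ S B, m y = 0%N & (B <= m + U_(y))%MM].
  move=> cy; have : comp_prime r 'X_y.
    by apply/midealX; exists y => //; rewrite mnm1E eqxx.
  rewrite PE /= mulrC => /midealMX/(_ m mf) /= [B /msum1P SB le].
  exists B; split=> //; apply/eqP; rewrite -leqn0 leqNgt; apply/negP => my.
  apply: Um; exists B; first exact/msum1P.
  apply/mnm_lepP => k; have /mnm_lepP/(_ k) := le; rewrite mnmDE mnm1E.
  case: eqP => [<-|_]; last by rewrite addn0.
  by move=> _; apply: leq_trans (Ssqf _ SB) my.
have [B [SB _ le]] := H r cr.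
move: ur; rewrite (cdeg_const (@in_comp_rel r) Su SB); apply/negP.
rewrite -leqNgt; apply: leq_trans (cdeg_le _ le) _.
rewrite cdegD cdeg1 [cdeg _ m]big1; first by case: (in_comp r r).
by move=> y /eqP cy; have [B' []] := H y cy.
Qed.

(** After the roots are identified with [z], the sum [l] of [z] and all non-root variables is one
    more regular element. If [l * g] lies in [V], so does [X_y * g], first for every non-root [y],
    then for [y = z]. *)
Lemma squarefree_depth : (size roots_seq < d)%N -> (0 < n)%N ->
  (size roots_seq <= depth (powI 1))%N.
Proof.
move=> cd n0; have [z [bs E]] := roots_split n0.
have cz : component z = z by apply/eqP; rewrite -mem_roots E mem_head.
pose h := merge_into z (catrev bs [::]).
pose V := up (mnm_map h @` up (msum S 1)).
have VE m : V m <-> exists2 B, S B & (mnm_map h B <= m)%MM.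
  split=> [[_ [u [B /msum1P SB Bu] <-] um]|[B SB Bm]].
    by exists B => //; apply: lepm_trans um; exact: mnm_map_le.
  exists (mnm_map h B) => //; exists B => //; exists B; first exact/msum1P.
  exact: lepm_refl.
have upV : up_closed V by exact: up_closed_up.
have mapB B y : component y != y -> mnm_map h B y = B y.
  move=> cy; rewrite mnm_mapE (big_pred1 y) // => i /=.
  have hy : h y = y by exact: merge_nonroot.
  apply/eqP/eqP => [hi|->//].
  case: (eqVneq (component i) i) => ci; last by rewrite -hi /h merge_nonroot.
  by move: cy; rewrite -hi /h merge_roots // cz eqxx.
(* [V] is squarefree in each non-root variable, as merging leaves its exponent in a basis
   unchanged. *)
have Vsq m y : component y != y -> V (m + U_(y) + U_(y))%MM -> V (m + U_(y))%MM.
  move=> cy /VE[B SB le]; apply/VE; exists B => //; apply/mnm_lepP => k.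
  have /mnm_lepP/(_ k) := le; rewrite !mnmDE mnm1E.
  case: eqP => [<-|_]; last by rewrite addn0.
  by move=> _; rewrite mapB //; have := Ssqf y SB; lia.
pose P (v : 'I_n) := (v == z) || (component v != v).
pose l : {mpoly K[n]} := \sum_(v | P v) 'X_v.
have Pz : P z by rewrite /P eqxx.
have hl : var_map h l = l.
  rewrite /l raddf_sum; apply: eq_bigr => v Pv /=.
  rewrite var_mapX mnm_map1; case/orP: Pv => [/eqP->|cv].
    by rewrite /h merge_roots.
  by rewrite /h merge_nonroot.
have lreg g : mideal V (l * g) -> mideal V g.
  move=> Vlg.
  have Vy y : component y != y -> mideal V ('X_y * g).
    move=> cy; have Py : P y by rewrite /P cy orbT.
    rewrite mulrC; apply/midealMX => m.
    (* Among the monomials [m] of [g] with [X_y * X^m] outside [V], the ones of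
       least degree in the other variables do not cancel in [l * g], since [V]
       is squarefree in [X_y]. *)
    have [N] := ubnP (mdeg m - m y).
    elim: N m => // N IH m /ltnSE le mg /=; apply: contrapT => Vm.
    have : (l * g)@_(m + U_(y)) = 0.
      by apply: memN_msupp_eq0; apply/negP => /Vlg.
    rewrite /l mulr_suml raddf_sum /= (bigD1 y) //= mcoeffXM.
    rewrite mnmDE mnm1E eqxx addn1 /= addmK big1 ?addr0.
      by apply/eqP; rewrite -mcoeff_msupp.
    move=> v /andP[Pv vy]; rewrite mcoeffXM mnmDE mnm1E eq_sym (negPf vy) addn0.
    case: ifPn => // mv; apply/eqP; rewrite mcoeff_eq0; apply/negP => m'g.
    have vm : (U_(v) <= m)%MM by rewrite lep1mP -lt0n.
    have m'E : (m + U_(y) - U_(v) = m - U_(v) + U_(y))%MM.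
      apply/mnmP => k; have := mnm_lepP vm k.
      by rewrite !mnmDE !mnmBE mnmDE; lia.
    apply: Vm; apply: upV (_ : V (m - U_(v) + U_(y))%MM) _; last first.
      by apply/mnm_lepP => k; rewrite !mnmDE mnmBE; lia.
    apply: Vsq => //; rewrite m'E in m'g; apply: (IH _ _ m'g).
    have mE : mdeg (m - U_(v) + U_(v)) = mdeg m by rewrite submK.
    rewrite mdegD mdeg1 in mE.
    rewrite mdegD mdeg1 mnmDE mnmBE !mnm1E eqxx (negPf vy).
    have : (m y + m v <= mdeg m)%N.
      rewrite mdegE (bigD1 y) //= (bigD1 v) //=; lia.
    by move: le mv mE; lia.
  have Vz : mideal V ('X_z * g).
    have -> : 'X_z * g = l * g - \sum_(v | P v && (v != z)) 'X_v * g.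
      by rewrite /l mulr_suml (bigD1 z Pz) /= addrK.
    have idV := is_ideal_mideal K upV; apply: (is_idealB idV) => //.
    apply: is_ideal_sum => // v /andP[/orP[/eqP->|cv]]; first by rewrite eqxx.
    by move=> _; exact: Vy.
  (* A monomial [m] of [g] outside [V] involves no non-root variable, so a basis that after merging
     divides [x_z m] is supported on roots. Being squarefree, its degree is at most the number of
     roots, which is less than [d]. *)
  move=> m mg; apply: contrapT => Vm.
  have m0 y : component y != y -> m y = 0%N.
    move=> cy; move: (Vy y cy); rewrite mulrC => /midealMX/(_ m mg) /= /VE[B SB le].
    apply/eqP; rewrite -leqn0 leqNgt; apply/negP => my; apply/Vm/VE; exists B => //.
    apply/mnm_lepP => k; have /mnm_lepP/(_ k) := le; rewrite mnmDE mnm1E.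
    case: eqP => [<-|_]; last by rewrite addn0.
    by move=> _; rewrite mapB //; apply: leq_trans (Ssqf _ SB) my.
  move: Vz; rewrite mulrC => /midealMX/(_ m mg) /= /VE[B SB le].
  have B0 y : component y != y -> B y = 0%N.
    move=> cy; have /mnm_lepP/(_ y) := le; rewrite mapB // mnmDE m0 // mnm1E.
    rewrite (_ : (z == y) = false) ?leqn0 => [/eqP//|].
    by apply/negP => /eqP zy; rewrite -zy cz eqxx in cy.
  move: cd; apply/negP; rewrite -leqNgt -(Sdeg SB) mdegE.
  rewrite (bigID (mem roots_seq)) /= addnC big1; last first.
    by move=> i; rewrite mem_roots => /B0.
  rewrite add0n -(card_uniqP roots_uniq) -sum1_card.
  by apply: leq_sum => i _; exact: Ssqf.
(* The preimage of the maximal ideal under the merging: a proper ideal containing the glued ideal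
   and [l], so the quotient by the whole sequence is nonzero. *)
pose M := [set f : {mpoly K[n]} | mideal (pvars setT) (var_map h f)].
have idM : is_ideal M.
  exact/is_ideal_var_map/is_ideal_mideal/up_closed_pvars.
have M1 : ~ M 1.
  rewrite /M /= rmorph1 => /(_ 0%MM); rewrite msupp1 mem_head => /(_ erefl).
  by move=> [i _]; rewrite mnm0E.
have Xmax i : @max_ideal K n 'X_i by apply: sub_gen_smallest; exists i.
have lmax : @max_ideal K n l.
  by apply: (@is_ideal_sum _ (@max_ideal K n)) => //; exact: is_ideal_gen.
pose s : seq {mpoly K[n]} := [seq 'X_b - 'X_z | b <- bs] ++ [:: l].
have -> : size roots_seq = size s by rewrite E size_cat size_map addn1.
have V0 : V `<=` pvars setT.
  move=> m /VE[B SB Bm]; apply: contrapT => nm.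
  have := Sdeg SB; rewrite -(mdeg_mnm_map h) => dE.
  move: (d_gt0 z); rewrite -dE mdegE big1 // => i _; apply/eqP.
  rewrite -leqn0; apply: leq_trans (mnm_lepP Bm i) _; rewrite leqNgt.
  by apply/negP => mi; apply: nm; exists i.
apply: (@depth_ge K n (powI 1) s n).
- by move=> y; rewrite /= mem_cat inE => /orP[/subX_max//|/eqP->].
- apply: regular_roots => //; apply/regular_seq_cons; first exact: is_ideal_glue.
  split.
    move=> f; by rewrite /glue /= rmorphM /= hl => /lreg.
  apply/regular_seq_nil; first exact: is_ideal_adjoin.
  move=> gT; apply: M1; suff : adjoin (glue h (up (msum S 1))) l `<=` M.
    by apply; rewrite gT.
  apply: smallest_sub => // f [gf|->]; rewrite /M /=.
    by move=> m /gf /V0.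
  by rewrite hl -max_idealE.
- move=> s' s'm regs'.
  apply: (regular_size_bound (x := fun i => 'X_i) (is_ideal_powI 1)
    (is_ideal_gen _ : is_ideal (@max_ideal K n)) _ _ _ regs') => //.
  + rewrite max_idealE => f Jf m /Jf[B /msum1P SB Bm]; apply: contrapT => nm.
    have := Sdeg SB => dE.
    move: (d_gt0 z); rewrite -dE mdegE big1 // => i _; apply/eqP.
    rewrite -leqn0; apply: leq_trans (mnm_lepP Bm i) _; rewrite leqNgt.
    by apply/negP => mi; apply: nm; exists i.
  + rewrite max_idealE => /(_ 0%MM); rewrite msupp1 mem_head => /(_ erefl).
    by move=> [i _]; rewrite mnm0E.
  + by move=> y; exact: max_seq_comb.
Qed.

End SquareFree.

(** * Powers of a product of disjoint monomial primes *)

Section TransversalPowers.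
Hypothesis Stransversal : size roots_seq = d.

Lemma Ass_transversal t : (0 < t)%N ->
  Ass (powI t) = [set P | exists2 r, component r = r & P = comp_prime r].
Proof.
move=> t0.
have upE m := up_msum_transversal Stransversal t m.
apply/seteqP; split=> [P [primeP [f PE]]|_ [r cr ->]]; last first.
  have [g pg] := transversal_pivot Stransversal t0.
  exact: pivot_Ass pg cr.
have [idP P1 PM] := primeP; have [P0 PD PZ] := idP.
have idJ := is_ideal_powI t; have [J0 JD JZ] := idJ.
have JP : powI t `<=` P by move=> q Jq; rewrite PE /= mulrC; exact: JZ.
have fJ : ~ powI t f by move=> Jf; apply: P1; rewrite PE /= mul1r.
(* Otherwise choose in each component a variable outside [P]; the product of their [t]-th powers
   lies in the power of the ideal, hence in the prime [P], a contradiction. *)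
have [r cr Pr] : exists2 r, component r = r & forall y, component y = r -> P 'X_y.
  apply: contrapT => nr.
  have H r : exists y, component r = r -> component y = r /\ ~ P 'X_y.
    case: (pselect (component r = r)) => [cr|]; last by exists r.
    apply: contrapT => ny; apply: nr; exists r => // y cy.
    by apply: contrapT => nPy; apply: ny; exists y.
  have {H}[a Ha] := choice H.
  pose m : 'X_{1..n} := [multinom (if i == a (component i) then t else 0%N) | i < n].
  have [i] : exists2 i, (0 < m i)%N & P 'X_i.
    apply: prime_monomial primeP _; apply/JP/midealX/upE => r cr.
    have [ca _] := Ha r cr.
    by rewrite /cdeg (bigD1 (a r)) ?/in_comp ?ca //= mnmE ca eqxx leq_addr.
  rewrite mnmE; case: eqP => [-> _|//].
  by have [_] := Ha _ (comp_root i).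
exists r => //; apply/seteqP; split; last first.
  rewrite /comp_prime -ideal_gen_vars; apply: smallest_sub => //.
  by move=> _ [y /Pr Py <-].
(* Since [X_r * f] lies in the power, monomials of [f] can have too small a degree only on the
   component of [r]. *)
have other r' m : m \in msupp f -> component r' = r' -> r' != r ->
    (t <= cdeg (in_comp r') m)%N.
  move=> mf cr' rr'; have := Pr r cr; rewrite PE /= mulrC => /midealMX/(_ m mf) /=.
  by move/upE/(_ r' cr'); rewrite cdegD cdeg1 /in_comp cr eq_sym (negPf rr') addn0.
move=> q Pq.
pose low m := (cdeg (in_comp r) m < t)%N.
pose avoid m := `[< ~ pvars [set i | component i = r] m >].
(* [f1] keeps the monomials of [f] outside the power, [q0] those of [q] outside the component prime.
   Their product lies in the power, yet its monomials would have degree below [t] on the component,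
   so it is 0. *)
pose f1 := restrict low f; pose q0 := restrict avoid q.
have qq0 : comp_prime r (q - q0).
  by move=> m; rewrite msupp_restrictB => /andP[/asboolPn/contrapT].
have ff1 : powI t (f - f1).
  move=> m; rewrite msupp_restrictB -leqNgt => /andP[tm mf]; apply/upE => r' cr'.
  by case: (eqVneq r' r) => [->//|rr']; exact: other.
have Jq0 : powI t ((q - q0) * f).
  have : P (q - q0).
    move: qq0; rewrite /comp_prime -ideal_gen_vars; apply: smallest_sub => //.
    by move=> _ [y /Pr Py <-].
  by rewrite PE.
have J01 : powI t (q0 * f1).
  have -> : q0 * f1 = q * f - (q - q0) * f - q0 * (f - f1) by ring.
  apply: (is_idealB idJ); last exact: JZ.
  by apply: (is_idealB idJ) => //; move: Pq; rewrite PE.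
have /eqP : q0 * f1 = 0.
  apply/msuppnil0; case E : (msupp _) => [//|m s].
  have mm : m \in msupp (q0 * f1) by rewrite E mem_head.
  have /upE/(_ r cr) := J01 _ mm; move: mm => /msuppM_le /allpairsP[[u v] /=].
  rewrite !msupp_restrict => -[/andP[/asboolP Nu _] /andP[lowv _] ->].
  rewrite cdegD [cdeg _ u]big1 => [|i /eqP ci].
    by rewrite leqNgt => /negP[].
  by apply/eqP; rewrite -leqn0 leqNgt; apply/negP => ui; apply: Nu; exists i.
rewrite mulf_eq0 => /orP[]/eqP E; first by rewrite E subr0 in qq0.
by rewrite E subr0 in ff1.
Qed.

Lemma powI1_prod : powI 1 = ideal_prod (fun i : 'I_d =>
  mideal (pvars [set j | component j = nth j roots_seq i])).
Proof.
rewrite ideal_prod_vars /powI; congr mideal.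
(* Indices stay below [d], the number of roots, so the default of [nth] is never returned. *)
have rE (i : 'I_d) j : component (nth j roots_seq i) = nth j roots_seq i.
  by apply/eqP; rewrite -mem_roots mem_nth // Stransversal.
apply/seteqP; split=> m.
  move/(up_msum_transversal Stransversal) => rm.
  have H (i : 'I_d) : exists y, component y = nth y roots_seq i /\ (0 < m y)%N.
    have j0 : 'I_n.
      have : (i < size roots_seq)%N by rewrite Stransversal.
      by case: roots_seq => // r.
    have := rm _ (rE i j0); apply: contraPP => ny; apply/negP; rewrite -leqNgt.
    rewrite /cdeg big1 // => y /eqP cy; apply/eqP; rewrite -leqn0 leqNgt.
    apply/negP => my; apply: ny; exists y; split=> //.
    by rewrite cy; apply: set_nth_default; rewrite Stransversal.
  have {H}[a Ha] := choice H; exists a => [i|]; first by have [] := Ha i.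
  apply/mnm_lepP => j; rewrite mnm_sumE.
  case: (pselect (exists i, a i = j)) => [[i ij]|nj]; last first.
    rewrite big1 // => i _; rewrite mnm1E; case: eqP => // ij.
    by case: nj; exists i.
  rewrite (bigD1 i) //= mnm1E ij eqxx big1 ?addn0.
    by have [_] := Ha i; rewrite ij.
  (* Distinct indices give distinct components, so [a] is injective and the product of the chosen
     variables is squarefree. *)
  move=> i' i'i; rewrite mnm1E; case: eqP => // i'j; case/eqP: i'i.
  have ir (k : 'I_d) : (k < size roots_seq)%N by rewrite Stransversal.
  apply/val_inj/eqP; rewrite /= -(nth_uniq j (ir _) (ir _) roots_uniq).
  have [+ _] := Ha i; rewrite ij => <-.
  by have [+ _] := Ha i'; rewrite i'j => <-.
move=> [a Aa le]; apply/(up_msum_transversal Stransversal).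
move=> r cr; have rr : r \in roots_seq by rewrite mem_roots cr.
have ri : (index r roots_seq < d)%N by rewrite -Stransversal index_mem.
have := Aa (Ordinal ri); set y := a _.
rewrite /= (set_nth_default r) ?index_mem // nth_index // => cy.
rewrite /cdeg (bigD1 y) /=; last by rewrite /in_comp cy.
apply: leq_trans (leq_addr _ _); apply: leq_trans (mnm_lepP le y).
by rewrite mnm_sumE (bigD1 (Ordinal ri)) //= mnm1E eqxx.
Qed.

End TransversalPowers.

End MonomialPowers.

End Polymatroid.

(** * Stability at 1 and bases of a matroidal ideal *)

Lemma stab_index_eq1 (T : Type) (f : nat -> T) :
  stab_index f = 1%N <-> forall t, (0 < t)%N -> f t = f 1%N.
Proof.
rewrite /stab_index; split=> [|f1].
  by case: xgetP => [y _ [[_ st] _] y1 t|//]; rewrite y1 in st; exact: st.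
apply: xget_unique; first by split=> // t1 [].
move=> t [[t0 _] /(_ 1%N (conj (leqnn _) f1)) t1].
by apply/eqP; rewrite eqn_leq t0 t1.
Qed.

Lemma antichain_mdeg (n d : nat) (S : set 'X_{1..n}) :
  (forall m, S m -> mdeg m = d) -> antichain S.
Proof.
move=> Sd s s' Ss Ss' le; have := Sd _ Ss'; rewrite -{1}(submK le) mdegD (Sd _ Ss).
move/eqP; rewrite -[X in _ == X]add0n eqn_add2r mdeg_eq0 => /eqP E.
by rewrite -(submK le) E add0m.
Qed.

(** Monomial generators of equal degree form an antichain, hence are [G I]. An exchanged monomial
    has degree [d] and lies in [I], so it is again a generator. *)
Lemma matroidal_bases (K : fieldType) (n d : nat) (I : set {mpoly K[n]}) :
  matroidal d I ->
  [/\ I = mideal (up (G I)), forall m, G I m -> mdeg m = d,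
      forall m i, G I m -> (m i <= 1)%N
    & forall u v, G I u -> G I v -> forall i, (v i < u i)%N ->
      exists j w, [/\ (u j < v j)%N, G I w & (w + U_(i) = u + U_(j))%MM]].
Proof.
move=> [[[S IS Sd] exch] [S' IS' Ssq]].
have {}IS : I = mideal (up S) by rewrite -ideal_gen_monomials.
have {}IS' : I = mideal (up S') by rewrite -ideal_gen_monomials.
have acS := antichain_mdeg Sd.
have GS : G I = S by exact: antichain_G.
rewrite GS in exch *.
have upE m : up S m -> mdeg m = d -> S m.
  move=> [s Ss sm] md; suff <- : s = m by [].
  have := md; rewrite -{1}(submK sm) mdegD (Sd _ Ss).
  move/eqP; rewrite -[X in _ == X]add0n eqn_add2r mdeg_eq0 => /eqP E.
  by rewrite -(submK sm) E add0m.
split=> //.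
  move=> m i Sm; have upS' : up S = up S' by apply: (@eq_mideal K); rewrite -IS.
  (* The squarefree generator [s'] is caught between [s] and [m], which coincide. *)
  have [s' Ss' s'm] : up S' m by rewrite -upS'; exists m => //; exact: lepm_refl.
  have [s Ss ss'] : up S s' by rewrite upS'; exists s' => //; exact: lepm_refl.
  have sE := acS _ _ Ss Sm (lepm_trans ss' s'm).
  by apply: leq_trans (Ssq _ Ss' i); rewrite -sE; exact: (mnm_lepP ss').
move=> u v Su Sv i vu; have [j uv] := exch u v Su Sv i vu.
have iu : (U_(i) <= u)%MM by rewrite lep1mP -lt0n; exact: leq_ltn_trans vu.
have E : (u - U_(i) + U_(j) + U_(i) = u + U_(j))%MM.
  by apply/mnmP => k; have := mnm_lepP iu k; rewrite !mnmDE mnmBE; lia.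
rewrite {1}IS => /midealX Uw; exists j, (u - U_(i) + U_(j))%MM; split=> //.
apply: upE => //; have : mdeg (u - U_(i) + U_(j) + U_(i)) = mdeg (u + U_(j)).
  by rewrite E.
by rewrite !mdegD !mdeg1 (Sd _ Su) => /addIn.
Qed.

Theorem theorem2p3 (K : fieldType) (n d : nat) (I : set {mpoly K[n]})
    (hmat : matroidal d I)
    (hfull : full_supported I)
    (hgcd : is_gcd (@monomials K n (G I)) 1) :
  (astab I = 1%N <-> dstab I = 1%N) /\
  (astab I = 1%N ->
   exists p : 'I_d -> set {mpoly K[n]},
     [/\ forall i, monomial_prime (p i),
         I = ideal_prod p
       & forall i j, i != j -> G (p i) `&` G (p j) = set0]).
Proof.
have [IE Sdeg Ssqf Sexch] := matroidal_bases hmat.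
set S := G I in IE Sdeg Ssqf Sexch *.
(* If [G I] were empty, 0 would be a common divisor of its elements and hence divide their gcd 1. *)
have Sn0 : exists m, S m.
  apply: contrapT => nS; have [_ gcd1] := hgcd; have [|h /eqP] := gcd1 0.
    by move=> f [m Sm _]; case: nS; exists m.
  by rewrite mulr0 oner_eq0.
have [u Su] := Sn0.
have rd := size_roots_le Sdeg Sexch hfull Sn0.
have n_gt0 (i : 'I_n) : (0 < n)%N by exact: leq_ltn_trans (ltn_ord i).
have expE t := ideal_exp_mideal t IE.
have transversal_Ass : size (roots_seq S) = d -> astab I = 1%N.
  move=> sd; apply/stab_index_eq1 => t t0.
  by rewrite !expE !(Ass_transversal Sdeg Sexch hfull Sn0).
have transversal_depth : size (roots_seq S) = d -> dstab I = 1%N.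
  move=> sd; apply/stab_index_eq1 => t t0; rewrite !expE.
  case: (posnP n) => [n0|n0]; last first.
    have dE k : (0 < k)%N ->
        depth (mideal (up (msum S k)) : set {mpoly K[n]}) = (size (roots_seq S)).-1.
      move=> k0; have [g pg] := transversal_pivot Sdeg Sexch hfull Sn0 sd k0.
      exact: (pivot_depth Sdeg Sexch hfull K n0 k0 pg).
    by rewrite !dE.
  (* With no variables the condition over the roots is vacuous, so all powers coincide. *)
  congr (depth (mideal _)); have H k m : up (msum S k) m.
    apply/(up_msum_transversal Sdeg Sexch hfull Sn0 sd) => r.
    by have := ltn_ord r; rewrite [X in (_ < X)%N]n0.
  by apply/seteqP; split=> m _; exact: H.
(* Some power has a pivot whatever the ranks are; both converse directions compare this power with
   [I] itself. *)
have [T [g [T0 pg]]] := exists_pivot hfull Sn0.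
have Ass_transversal1 : astab I = 1%N -> size (roots_seq S) = d.
  move=> /stab_index_eq1/(_ T T0); rewrite !expE => AE.
  apply/eqP; rewrite eqn_leq rd leqNgt; apply/negP => lt.
  have [r cr ur] := size_roots_lt Sdeg lt Su.
  apply: (not_Ass_squarefree Sdeg Sexch Ssqf Su cr ur (K := K)).
  rewrite -AE; exact: (pivot_Ass Sdeg Sexch Sn0 K pg cr).
have depth_transversal : dstab I = 1%N -> size (roots_seq S) = d.
  move=> /stab_index_eq1/(_ T T0); rewrite !expE => DE.
  apply/eqP; rewrite eqn_leq rd leqNgt; apply/negP => lt.
  have [r cr ur] := size_roots_lt Sdeg lt Su.
  have n0 := n_gt0 r.
  (* The depth is at least the number of components for [I], but one less for the power with a
     pivot. *)
  have := squarefree_depth Sdeg Sexch hfull K Ssqf lt n0.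
  rewrite -DE (pivot_depth Sdeg Sexch hfull K n0 T0 pg).
  by have [z [bs ->]] := roots_split S n0; rewrite ltnn.
split; first by split=> [/Ass_transversal1|/depth_transversal].
move=> /Ass_transversal1 sd.
exists (fun i : 'I_d =>
  mideal (pvars [set j | component S j = nth j (roots_seq S) i])); split.
- move=> i; split; first exact: mideal_pvars_prime.
  by exists [set j | component S j = nth j (roots_seq S) i]; rewrite ideal_gen_vars.
- rewrite -(powI1_prod Sdeg Sexch hfull Sn0 K sd) {1}IE.
  congr (mideal (up _)); apply/seteqP; split=> m; first exact: msum1.
  by move/msum1P.
- move=> i j ij; rewrite !G_vars; apply/seteqP; split=> // m [[k ck <-] [l cl /eqP E]].
  have {E} lk : l = k.
    by apply/eqP; move: E => /eqP/mnmP/(_ k); rewrite !mnm1E eqxx; case: eqP.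
  rewrite lk /= ck in cl; move/eqP: cl; rewrite nth_uniq ?roots_uniq ?sd //.
  by rewrite val_eqE (negPf ij).
Qed.
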